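(* Let $q\in\mathbb N_1$ and let $P_\bullet=(P_n)_{n\ge0}$ be a $q$-chromatic partition structure represented by the Borel probability measure $\mu$ on $\boldsymbol\nabla^{(q)}_0$, i.e. $P_n[A]=\int\psi_A\,d\mu$ for all $n\in\mathbb N_0$ and $A\in\mathcal A^{(q)}_n$. Then: (1) $P_\bullet$ is a standard (one-color) partition structure if and only if there is a fixed $j\in[q]$ such that, for $\mu$-a.e. $\mathbf x$, $\mathbf x_i\propto\mathbf e_j$ for every $i\ge0$; (2) $P_\bullet$ is a multipartition structure if and only if, for $\mu$-a.e. $\mathbf x$ and every $i\ge1$, there is $j_i=j_i(\mathbf x)\in[q]$ (depending on $i$ and $\mathbf x$) with $\mathbf x_i\propto\mathbf e_{j_i}$; (3) $P_\bullet$ is of partially exchangeable type if and only if $\mathbf D_\sharp\mu=\delta_{\mathbf p}$ for some $\mathbf p\in\Delta^{q-1}$, where $\mathbf D(\mathbf x)=\sum_{i\ge0}\mathbf x_i$ and $\mathbf D_\sharp\mu$ is the push-forward. Here $\mathbf v\propto\mathbf e_j$ means $\mathbf v=c\,\mathbf e_j$ for some $c\ge0$.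
   Context: Notation: $\mathbb N_1=\{1,2,\dots\}$, $\mathbb N_0=\{0,1,\dots\}$, $[q]=\{1,\dots,q\}$, $\mathbb N^q_*=\mathbb N_0^q\setminus\{\mathbf 0\}$, $0^0=1$; $|\mathbf a|=\sum_j|a_j|$, $\mathbf a!=\prod_ja_j!$, $\mathbf x^{\mathbf a}=\prod_jx_j^{a_j}$, $\binom{|\mathbf a|}{\mathbf a}=|\mathbf a|!/\mathbf a!$; $\mathbf e_j$ canonical basis vectors; $\Delta^{q-1}=\{\mathbf u\in[0,1]^q:|\mathbf u|=1\}$. A $q$-chromatic partition of $n$ is a finitely supported map $A\colon\mathbb N^q_*\to\mathbb N_0$ with $\sum_{\mathbf a}A(\mathbf a)|\mathbf a|=n$; $\mathcal A^{(q)}_n$ is the set of these ($\mathcal A_0^{(q)}=\{0\}$); $\mathbf 1_{\mathbf a}$ is the multiset with single element $\mathbf a$; operations and $\le$ pointwise; $\mathrm{supp}A$ support, $s(A)=\sum_{\mathbf a} A(\mathbf a)$. For $\mathbf n\in\mathbb N_0^q$, $\mathcal A_{\mathbf n}=\{A:\sum_{\mathbf a}A(\mathbf a)\mathbf a=\mathbf n\}$. For $\mathbf a\in\mathrm{supp}A$, $a_j\ge1$: $A_{\setminus\mathbf a,j}=A-\mathbf 1_{\mathbf a}$ if $\mathbf a=\mathbf e_j$, else $A-\mathbf 1_{\mathbf a}+\mathbf 1_{\mathbf a-\mathbf e_j}$. $S_{n-1,n}(A,B)=a_jA(\mathbf a)/n$ if $B=A_{\setminus\mathbf a,j}$, $0$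 otherwise. A $q$-chromatic partition structure is a sequence $(P_n)_{n\ge0}$ of probability measures on $\mathcal A^{(q)}_n$ with $P_{n-1}[B]=\sum_{A\in\mathcal A^{(q)}_n}P_n[A]S_{n-1,n}(A,B)$ for all $n\ge1$, $B\in\mathcal A^{(q)}_{n-1}$. It is a standard partition structure if there is $j\in[q]$ such that every $P_n$ is concentrated on the $A$ all of whose blocks $\mathbf a\in\mathrm{supp}A$ are of the form $a\,\mathbf e_j$ (only color $j$ occurs). It is a multipartition structure if every $P_n$ is concentrated on the $A\in\mathcal A^{(q)}_n$ such that each $\mathbf a\in\mathrm{supp}A$ is of the form $a\,\mathbf e_k$ for some $a\in[n]$, $k\in[q]$ (with $k$ depending on $\mathbf a$). A partially exchangeable partition structure is a family $(Q_{\mathbf n})_{\mathbf n\in\mathbb N_0^q}$ of probability measures $Q_{\mathbf n}$ on $\mathcal A_{\mathbf n}$ with $Q_{\mathbf n-\mathbf e_j}[B]=\sum_{A\in\mathcal A_{\mathbf n}}Q_{\mathbf n}[A]S^j_{\mathbf n}(A,B)$ for all $\mathbf n$, $j$ with $n_j\ge1$, $B\in\mathcal A_{\mathbf n-\mathbf e_j}$, where $S^j_{\mathbf n}(A,B)=a_jA(\mathbf a)/n_j$ if $B=A_{\setminus\mathbf a,j}$ and $0$ otherwise. $P_\bullet$ is of partially exchangeable type if there are $\mathbf p\in\Delta^{q-1}$ and such a family with $P_n=\sum_{\mathbf n\in\mathbb N_0^q:|\mathbf n|=n}\binom n{\mathbf n}\mathbf p^{\mathbf n}Q_{\mathbf n}$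 for all $n\in\mathbb N_0$. Shortlex order: $\mathbf s<_{\mathrm{sl}}\mathbf t$ iff $(|\mathbf s|,s_1,\dots,s_q)<(|\mathbf t|,t_1,\dots,t_q)$ lexicographically. $\boldsymbol\nabla^{(q)}_0$ is the set of sequences $\mathbf x=(\mathbf x_i)_{i\ge0}$ in $[0,\infty)^q$ with $\mathbf x_i\ge_{\mathrm{sl}}\mathbf x_{i+1}$ for $i\ge1$ and $\sum_{i\ge0}|\mathbf x_i|=1$, with the Borel $\sigma$-algebra of the product topology. For $A\in\mathcal A^{(q)}_n$ let $(\mathbf a_h)_{h\in[s(A)]}$ list all $\mathbf a\in\mathrm{supp}A$ with multiplicity $A(\mathbf a)$ in decreasing shortlex order, and $T_r$ be the set of injective maps $[r]\to\mathbb N_1$ ($T_0=\{\varnothing\}$). $\varphi_0\equiv1$, $\varphi_A(\mathbf x)=n!\big(\prod_{\mathbf a\in\mathrm{supp}A}\frac1{\mathbf a!^{A(\mathbf a)}A(\mathbf a)!}\big)\sum_{\iota\in T_{s(A)}}\prod_{h=1}^{s(A)}\mathbf x_{\iota(h)}^{\mathbf a_h}$; with $\mathrm{dust}(\mathbf m)=\sum_jm_j\mathbf 1_{\mathbf e_j}$, $\psi_0\equiv1$ and $\psi_A(\mathbf x)=n!\sum_{\mathbf m\in\mathbb N_0^q,\,\mathrm{dust}(\mathbf m)\le A}\frac{\mathbf x_0^{\mathbf m}}{\mathbf m!(n-|\mathbf m|)!}\varphi_{A-\mathrm{dust}(\mathbf m)}(\mathbf x)$. Every $q$-chromatic partition structure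 is represented by exactly one such $\mu$. *)

(* Defs.v *)
From HB Require Import structures.
From mathcomp Require Import all_boot all_order all_algebra.
From mathcomp Require Import finmap multiset.
From mathcomp Require Import all_classical all_reals all_analysis.

Set Implicit Arguments.
Unset Strict Implicit.
Unset Printing Implicit Defensive.

Import Order.TTheory GRing.Theory Num.Theory numFieldNormedType.Exports.

Local Open Scope classical_set_scope.
Local Open Scope ring_scope.

Notation cvec q := {ffun 'I_q -> nat}.

Section ColorVectors.
Variable q : nat.
Implicit Types a : cvec q.

Definition cvec0 : cvec q := [ffun=> 0%N].

Definition cunit (j : 'I_q) : cvec q := [ffun k => nat_of_bool (k == j)].

Definition cscale (m : nat) a : cvec q := [ffun k => (m * a k)%N].

Definition cpred a (j : 'I_q) : cvec q := [ffun k => (a k - cunit j k)%N].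

Definition cweight a : nat := (\sum_j a j)%N.

Definition cfact a : nat := (\prod_j (a j)`!)%N.

End ColorVectors.

Section Monomials.
Variables (R : realType) (q : nat).

Definition monom (x : 'rV[R]_q) (a : cvec q) : R := \prod_j x 0 j ^+ a j.

Definition l1norm (x : 'rV[R]_q) : R := \sum_j `|x 0 j|.

Definition unit_simplex : set 'rV[R]_q :=
  [set p : 'rV[R]_q | (forall j, 0 <= p 0 j <= 1) /\ l1norm p = 1].

Definition prop_to_unit (x : 'rV[R]_q) (j : 'I_q) : Prop :=
  exists2 c : R, 0 <= c & x = c *: delta_mx 0 j.

(** Shortlex order: [seqlexi] compares these equally long sequences
    lexicographically. *)
Definition shortlexN (a b : cvec q) : bool :=
  ((cweight a :: [seq a j | j <- enum 'I_q] : seqlexi nat)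
     <= (cweight b :: [seq b j | j <- enum 'I_q] : seqlexi nat))%O.

Definition shortlexR (x y : 'rV[R]_q) : bool :=
  ((l1norm x :: [seq x 0 j | j <- enum 'I_q] : seqlexi R)
     <= (l1norm y :: [seq y 0 j | j <- enum 'I_q] : seqlexi R))%O.

End Monomials.

(** A finite multiset of color vectors is a finitely supported map to [nat];
    that it lives on nonzero vectors is part of [chromatic] and
    [chromatic_by] below. *)
Notation cpart q := {mset {ffun 'I_q -> nat}}%mset.

Section Partitions.
Variable q : nat.
Implicit Types (A B : cpart q) (a n : cvec q).

Definition csize A : nat := (\sum_(a <- finsupp A) A a * cweight a)%N.

Definition chromatic (n : nat) : set (cpart q) :=
  [set A : cpart q | cvec0 q \notin A /\ csize A = n].

Definition chromatic_by n : set (cpart q) :=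
  [set A : cpart q | cvec0 q \notin A /\
           forall j, (\sum_(a <- finsupp A) A a * a j)%N = n j].

Definition remove A a (j : 'I_q) : cpart q :=
  (if a == cunit j then A `\ a else cpred a j +` (A `\ a))%mset.

Definition dust (m : cvec q) : cpart q :=
  \big[msetD/mset0]_(j < q) msetn (m j) (cunit j).

Definition blocks A : seq (cvec q) :=
  sort (fun a b => shortlexN b a) (enum_mset A).

End Partitions.

Section Structures.
Variables (R : realType) (q : nat).
Implicit Types (A B : cpart q).

(** Probability measures on a finite set [E] of partitions, given by their mass
    functions extended by 0 outside [E]. *)
Definition prob_on (E : set (cpart q)) (p : cpart q -> R) : Prop :=
  [/\ forall A, 0 <= p A,
      forall A, ~ E A -> p A = 0 &
      \sum_(A \in E) p A = 1].

Definition concentrated (p : cpart q -> R) (E : set (cpart q)) : Prop :=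
  forall A, ~ E A -> p A = 0.

(** In the next two sums at most one term is nonzero: for [a] in the support
    and [0 < a j], [remove A a j] determines [a] and [j]. *)
Definition sample (n : nat) A B : R :=
  \sum_(a <- finsupp A) \sum_(j < q | (0 < a j)%N && (B == remove A a j))
    (a j * A a)%:R / n%:R.

Definition sample_color (n : cvec q) (j : 'I_q) A B : R :=
  \sum_(a <- finsupp A | (0 < a j)%N && (B == remove A a j))
    (a j * A a)%:R / (n j)%:R.

Definition partition_structure (P : nat -> cpart q -> R) : Prop :=
  (forall n, prob_on (chromatic n) (P n)) /\
  forall (n : nat) B, (0 < n)%N -> chromatic n.-1 B ->
    P n.-1 B = \sum_(A \in chromatic n) P n A * sample n A B.

Definition standard_structure (P : nat -> cpart q -> R) : Prop :=
  exists j : 'I_q, forall n,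
    concentrated (P n)
      [set A : cpart q | chromatic n A /\
        forall a, a \in finsupp A -> exists m : nat, a = cscale m (cunit j)].

Definition multipartition_structure (P : nat -> cpart q -> R) : Prop :=
  forall n,
    concentrated (P n)
      [set A : cpart q | chromatic n A /\
        forall a, a \in finsupp A ->
          exists (m : nat) (k : 'I_q), (1 <= m <= n)%N /\ a = cscale m (cunit k)].

Definition partially_exchangeable (Q : cvec q -> cpart q -> R) : Prop :=
  (forall n, prob_on (chromatic_by n) (Q n)) /\
  forall (n : cvec q) (j : 'I_q) B, (0 < n j)%N -> chromatic_by (cpred n j) B ->
    Q (cpred n j) B = \sum_(A \in chromatic_by n) Q n A * sample_color n j A B.

Definition partially_exchangeable_type (P : nat -> cpart q -> R) : Prop :=
  exists (p : 'rV[R]_q) (Q : cvec q -> cpart q -> R),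
    [/\ unit_simplex p, partially_exchangeable Q &
        forall (n : nat) A,
          P n A = \sum_(m \in [set m : cvec q | cweight m = n])
                    (n`!%:R / (cfact m)%:R) * monom p m * Q m A].

End Structures.

Section Nabla.
Variables (R : realType) (q : nat).

(** [{ptws nat -> _}] carries the product topology. *)
Definition nabla : set {ptws nat -> 'rV[R]_q} :=
  [set x : {ptws nat -> 'rV[R]_q} | [/\ forall i j, 0 <= x i 0 j,
               forall i, (1 <= i)%N -> shortlexR (x i.+1) (x i) &
               series (fun i => l1norm (x i)) @ \oo --> (1 : R)]].

Definition color_mass (x : nat -> 'rV[R]_q) : 'rV[R]_q :=
  \row_j limn (series (fun i => x i 0 j)).

Local Open Scope ereal_scope.

(** The listing [blocks A] is indexed from 0. The case of the empty partition
    needs no special treatment: the formulas give 1. *)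
Definition phi (A : cpart q) (x : nat -> 'rV[R]_q) : \bar R :=
  (((csize A)`!)%:R *
     \prod_(a <- finsupp A) ((cfact a ^ A a * (A a)`!)%N%:R)^-1)%:E *
  \esum_(iota in [set iota : {ffun 'I_(size (blocks A)) -> nat} |
                   injective iota /\ forall h, (1 <= iota h)%N])
    (\prod_h monom (x (iota h)) (nth (cvec0 q) (blocks A) h))%:E.

Definition psi (A : cpart q) (x : nat -> 'rV[R]_q) : \bar R :=
  (((csize A)`!)%:R)%:E *
  \sum_(m \in [set m : cvec q | (dust m `<=` A)%mset])
    (monom (x 0%N) m / (cfact m * (csize A - cweight m)`!)%N%:R)%:E *
    phi (A `\` dust m)%mset x.

End Nabla.

(** [measurableType] requires a point, which exists when there is at least one
    color; hence [q.+1]. *)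
Definition nabla_type (R : realType) (q : nat) : Type := set_type (@nabla R q.+1).

HB.instance Definition _ R q := Topological.on (nabla_type R q).

Definition nabla_point_seq (R : realType) (q : nat) : {ptws nat -> 'rV[R]_q.+1} :=
  fun i => if i == 0%N then delta_mx 0 0 else 0.

Lemma nabla_point_subproof (R : realType) (q : nat) :
  nabla_point_seq R q \in @nabla R q.+1.
Proof.
apply/mem_set; split.
- by move=> i j; rewrite /nabla_point_seq; case: eqP => _; rewrite mxE ?ler0n.
- by case=> // i _; rewrite /nabla_point_seq /=; exact: lexx.
- apply: cvg_near_cst; exists 1%N => // n /= n1.
  rewrite /series /= big_ltn // big_nat_cond big1 ?addr0 => [|i /andP[/andP[]]].
    rewrite /l1norm (bigD1 0) //= big1 ?addr0 => [|j j0]; rewrite !mxE.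
      by rewrite !eqxx normr1.
    by rewrite (negPf j0) normr0.
  case: i => // i _ _ _; rewrite /l1norm big1 // => j _.
  by rewrite mxE normr0.
Qed.

HB.instance Definition _ R q := isPointed.Build (nabla_type R q)
  (exist (fun x => x \in @nabla R q.+1) _ (nabla_point_subproof R q)).

Definition nabla_seq (R : realType) (q : nat) (x : nabla_type R q) :
  nat -> 'rV[R]_q.+1 := set_val x.

Notation borel T := (g_sigma_algebraType (open : set (set T))).

(* Main.v *)
Require Import Defs.
From HB Require Import structures.
From mathcomp Require Import all_boot all_order all_algebra.
From mathcomp Require Import finmap multiset.
From mathcomp Require Import all_classical all_reals all_analysis.
From mathcomp Require Import measurable_realfun.
From mathcomp Require Import ring lra zify.

Set Implicit Arguments.
Unset Strict Implicit.
Unset Printing Implicit Defensive.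

Import Order.TTheory GRing.Theory Num.Theory numFieldNormedType.Exports.

Local Open Scope classical_set_scope.
Local Open Scope ring_scope.

(** Throw [n] points independently, each getting color [j] and falling into
    box [i] with probability [x i 0 j]. The points in a box [i >= 1] form one
    block; every point in box 0, the dust, is a block of its own. Then
    [psi A x] is the probability that the blocks form [A], and
    [color_mass x 0 j] is the probability that a point has color [j]. The three
    equivalences rest on two consequences of this picture.

    First, [psi A x] vanishes as soon as some block of [A] fits into no box
    ([box_mass_eq0]). This gives the implications from [mu] to [P] in the
    first two equivalences. For their converses, two values of [P] are enough:
    the mean of [color_mass x 0 k] is the [P 1]-mass of the partition with a
    single point, of color [k], and the [P 2]-mass of the block [e_j + e_k] is
    a positive multiple of the mean of the sum of [x i 0 j * x i 0 k] over
    [i >= 1]. If such a mean is zero, then so are all terms almost everywhere.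

    Second, throwing one more point of color [j] and forgetting it again
    multiplies the probability of [B] by the mass of color [j]:
    [D_j * psi B] is the sum over [A] of [psi A] times the probability that
    removing a uniformly chosen point of [A] takes away color [j] and leaves
    [B] ([box_mass_removals]). Summing over [B] and inducting on the color
    counts [n] yields the multinomial formula for the probability of these
    counts ([box_mass_total]). Hence, if [P] is of partially exchangeable type
    with parameter [p], all mixed moments of [color_mass] are those of the
    constant [p]; the moments of orders 1 and 2 already show that each
    coordinate has mean [p 0 j] and variance zero ([color_mass_ae]).

    Conversely, let [color_mass] be almost everywhere equal to [p]. One wants
    [Q n] to be [P] conditioned on the color counts [n], and the integrated
    second consequence is exactly the consistency of this family. Conditioning
    is impossible when [n] involves a color of mass zero. This is cured by
    adding dust of weight 1 in each such color before integrating: both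
    consequences hold for arbitrary nonnegative weights of finite total, the
    partitions that avoid the null colors keep their masses, and the others
    have probability zero anyway ([mixture_cond_mass]).

    The sums over injective maps in [psi] are handled through the recursion
    [placement], which places the blocks one at a time; [psiE] rewrites [psi]
    in these terms. *)

(** * Color vectors and monomials *)

Section ColorVectorsTheory.
Variable q : nat.
Implicit Types (a b : cvec q) (j k : 'I_q).

Definition cadd a j : cvec q := [ffun k => (a k + cunit j k)%N].

Lemma caddE a j k : cadd a j k = (a k + (k == j))%N.
Proof. by rewrite !ffunE. Qed.

Lemma cadd_diag a j : cadd a j j = (a j).+1.
Proof. by rewrite caddE eqxx addn1. Qed.

Lemma cpredE a j k : cpred a j k = (a k - (k == j))%N.
Proof. by rewrite !ffunE. Qed.

Lemma caddK a j : cpred (cadd a j) j = a.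
Proof. by apply/ffunP => k; rewrite cpredE caddE addnK. Qed.

Lemma cpredK a j : (0 < a j)%N -> cadd (cpred a j) j = a.
Proof.
move=> aj; apply/ffunP => k; rewrite caddE cpredE subnK //.
by case: eqP => // ->.
Qed.

Lemma cadd0 j : cadd (cvec0 q) j = cunit j.
Proof. by apply/ffunP => k; rewrite !ffunE. Qed.

Lemma cunit_diag j : cunit j j = 1%N :> nat.
Proof. by rewrite ffunE eqxx. Qed.

Lemma cadd_eq_unit a j : (cadd a j == cunit j) = (a == cvec0 q).
Proof.
apply/eqP/eqP => [/(congr1 (fun b => cpred b j))|->]; last exact: cadd0.
by rewrite caddK -(cadd0 j) caddK.
Qed.

Lemma cadd_neq0 a j : cadd a j != cvec0 q.
Proof.
by apply/eqP => /ffunP/(_ j); rewrite cadd_diag ffunE.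
Qed.

Lemma cweight_cadd a j : cweight (cadd a j) = (cweight a).+1.
Proof.
rewrite /cweight; under eq_bigr do rewrite caddE.
rewrite big_split /= -addn1; congr addn.
by rewrite (bigD1 j) //= eqxx big1 // => k /negbTE ->.
Qed.

Lemma cweight_eq0 a : (cweight a == 0%N) = (a == cvec0 q).
Proof.
rewrite /cweight sum_nat_eq0; apply/forallP/eqP => [H|-> j]; last by rewrite ffunE.
by apply/ffunP => j; rewrite ffunE; exact/eqP/H.
Qed.

Lemma cvec_neq0P a : a != cvec0 q -> exists j, (0 < a j)%N.
Proof.
move=> a0; apply/existsP; apply/contraT; rewrite negb_exists => /forallP H.
by case/negP: a0; apply/eqP/ffunP => j; rewrite ffunE; apply/eqP; rewrite -leqn0 leqNgt H.
Qed.

Lemma cweight_unitP a : reflect (exists j, a = cunit j) (cweight a == 1%N).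
Proof.
apply: (iffP idP) => [|[j ->]]; last first.
  by rewrite -cadd0 cweight_cadd eqSS cweight_eq0.
move=> a1; have [|j aj] := @cvec_neq0P a.
  by rewrite -cweight_eq0 (eqP a1).
exists j; apply/eqP; rewrite -(cpredK aj) cadd_eq_unit -cweight_eq0.
by rewrite -eqSS -(cweight_cadd _ j) cpredK.
Qed.

Lemma cfact_cadd a j : cfact (cadd a j) = ((a j).+1 * cfact a)%N.
Proof.
rewrite /cfact (bigD1 j) //= [in RHS](bigD1 j) //= cadd_diag factS mulnA.
by congr muln; apply: eq_bigr => k /negbTE kj; rewrite caddE kj addn0.
Qed.

Lemma cfact_gt0 a : (0 < cfact a)%N.
Proof. by rewrite /cfact prodn_gt0 // => j; exact: fact_gt0. Qed.

Lemma cfact0 : cfact (cvec0 q) = 1%N.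
Proof. by rewrite /cfact big1 // => j _; rewrite ffunE. Qed.

Lemma cfact_unit j : cfact (cunit j) = 1%N.
Proof. by rewrite -cadd0 cfact_cadd cfact0 ffunE. Qed.

Lemma cweight0 : cweight (cvec0 q) = 0%N.
Proof. by apply/eqP; rewrite cweight_eq0. Qed.

Lemma cvec_ind (Pr : cvec q -> Prop) :
  Pr (cvec0 q) -> (forall a j, Pr a -> Pr (cadd a j)) -> forall a, Pr a.
Proof.
move=> P0 PS a; move: {2}(cweight a) (erefl (cweight a)) => n.
elim: n a => [|n IH] a an; first by move/eqP: an; rewrite cweight_eq0 => /eqP ->.
have [|j aj] := @cvec_neq0P a; first by rewrite -cweight_eq0 an.
rewrite -(cpredK aj); apply: PS; apply: IH.
by apply/eqP; rewrite -eqSS -(cweight_cadd _ j) cpredK // an.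
Qed.

End ColorVectorsTheory.

Section MonomialsTheory.
Variables (R : realType) (q : nat).
Implicit Types (z : 'rV[R]_q) (a : cvec q) (j : 'I_q).

Lemma monom_ge0 z a : (forall j, 0 <= z 0 j) -> 0 <= monom z a.
Proof. by move=> z0; apply: prodr_ge0 => j _; exact: exprn_ge0. Qed.

Lemma monom_cadd z a j : monom z (cadd a j) = monom z a * z 0 j.
Proof.
rewrite /monom (bigD1 j) //= [in RHS](bigD1 j) //= cadd_diag exprSr.
rewrite mulrAC; congr (_ * _ * _); apply: eq_bigr => k /negbTE kj.
by rewrite caddE kj addn0.
Qed.

Lemma monom0 z : monom z (cvec0 q) = 1.
Proof. by rewrite /monom big1 // => j _; rewrite ffunE. Qed.

Lemma monom_unit z j : monom z (cunit j) = z 0 j.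
Proof. by rewrite -cadd0 monom_cadd monom0 mul1r. Qed.

Lemma monom_eq0 z a j : (0 < a j)%N -> z 0 j = 0 -> monom z a = 0.
Proof. by move=> aj zj; rewrite -(cpredK aj) monom_cadd zj mulr0. Qed.

End MonomialsTheory.

(** * Placing blocks into boxes *)

Section AssignmentSums.
Variables (R : realType) (q : nat) (y : 'rV[R]_q) (x : nat -> 'rV[R]_q).
Implicit Types (a b : cvec q) (s : seq (cvec q)) (u : seq nat) (j : 'I_q).
Hypothesis y_ge0 : forall j, 0 <= y 0 j.
Hypothesis x_ge0 : forall i j, 0 <= x i 0 j.

Local Open Scope ereal_scope.

(** The sum, over all ways to send the blocks of [s] to distinct boxes outside
    [u], of the products of the corresponding monomials; a block of one point
    may also become dust, which has weight [y]. The list [u] of occupied boxes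
    starts as [[:: 0]], since index 0 is not a box. *)
Fixpoint placement (s : seq (cvec q)) (u : seq nat) : \bar R :=
  if s is a :: s' then
    (if cweight a == 1%N then (monom y a)%:E * placement s' u else 0) +
    \sum_(i <oo | i \notin u) (monom (x i) a)%:E * placement s' (i :: u)
  else 1.

Arguments placement : simpl never.

Lemma placement_nil u : placement [::] u = 1.
Proof. by []. Qed.

Lemma placementE a s u : placement (a :: s) u =
  (if cweight a == 1%N then (monom y a)%:E * placement s u else 0) +
  \sum_(i <oo | i \notin u) (monom (x i) a)%:E * placement s (i :: u).
Proof. by []. Qed.

Opaque placement.

Lemma monomx_ge0 i a : 0 <= (monom (x i) a)%:E.
Proof. by rewrite lee_fin monom_ge0. Qed.

Lemma monomy_ge0 a : 0 <= (monom y a)%:E.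
Proof. by rewrite lee_fin monom_ge0. Qed.

Lemma placement_ge0 s u : 0 <= placement s u.
Proof.
elim: s u => [|a s IH] u; first exact: lee01.
rewrite placementE; apply: adde_ge0.
  by case: ifP => // _; rewrite mule_ge0 // monomy_ge0.
by apply: nneseries_ge0 => i _ _; rewrite mule_ge0 // monomx_ge0.
Qed.

Hint Resolve placement_ge0 monomx_ge0 monomy_ge0 : core.

Lemma placement_term_ge0 i a s u : 0 <= (monom (x i) a)%:E * placement s u.
Proof. by rewrite mule_ge0. Qed.

Hint Resolve placement_term_ge0 : core.

Lemma eq_placement s u v : u =i v -> placement s u = placement s v.
Proof.
elim: s u v => [//|a s IH] u v uv; rewrite !placementE; congr (_ + _).
  by case: ifP => // _; rewrite (IH _ v).
rewrite (@eq_eseriesl _ _ (fun i => i \notin v)); last by move=> i; rewrite uv.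
apply: eq_eseriesr => i _; congr (_ * _); apply: IH => k.
by rewrite !in_cons uv.
Qed.

Lemma placement_nodust a s u : cweight a != 1%N ->
  placement (a :: s) u =
  \sum_(i <oo | i \notin u) (monom (x i) a)%:E * placement s (i :: u).
Proof. by move=> /negbTE a1; rewrite placementE a1 add0e. Qed.

(** Both sides sum over ordered pairs of distinct free boxes, one for each of
    the two blocks. *)
Let placement_cross a b s u :
  \sum_(i <oo | i \notin u) (monom (x i) a)%:E *
    (\sum_(k <oo | k \notin i :: u) (monom (x k) b)%:E * placement s (k :: i :: u)) =
  \sum_(i <oo | i \notin u) (monom (x i) b)%:E *
    (\sum_(k <oo | k \notin i :: u) (monom (x k) a)%:E * placement s (k :: i :: u)).
Proof.
pose F (a b : cvec q) i k := if k == i then 0 else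
  (monom (x i) a)%:E * ((monom (x k) b)%:E * placement s (k :: i :: u)).
have F_ge0 a' b' : forall i k, 0 <= F a' b' i k.
  by move=> i k; rewrite /F; case: ifP => // _; rewrite mule_ge0.
have E a' b' : \sum_(i <oo | i \notin u) (monom (x i) a')%:E *
    (\sum_(k <oo | k \notin i :: u) (monom (x k) b')%:E * placement s (k :: i :: u)) =
    \sum_(i <oo | i \notin u) \sum_(k <oo | k \notin u) F a' b' i k.
  apply: eq_eseriesr => i _; rewrite -nneseriesZl //.
  rewrite [LHS]eseries_mkcond [RHS]eseries_mkcond; apply: eq_eseriesr => k _.
  by rewrite in_cons negb_or /F; case: eqP => //=; case: ifP.
rewrite (E a b) (E b a).
rewrite (nneseries_interchange _ _ (F_ge0 a b)); apply: eq_eseriesr => i _.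
apply: eq_eseriesr => k _; rewrite /F eq_sym; case: eqP => // _.
rewrite muleCA; congr (_ * (_ * _)); apply: eq_placement => l.
by rewrite !in_cons orbCA.
Qed.

Lemma placement_swap a b s u : placement (a :: b :: s) u = placement (b :: a :: s) u.
Proof.
have E c d : placement (c :: d :: s) u =
  (if (cweight c == 1%N) && (cweight d == 1%N) then
     (monom y c)%:E * (monom y d)%:E * placement s u else 0) +
  (if cweight c == 1%N then \sum_(i <oo | i \notin u)
     (monom y c)%:E * ((monom (x i) d)%:E * placement s (i :: u)) else 0) +
  (if cweight d == 1%N then \sum_(i <oo | i \notin u)
     (monom y d)%:E * ((monom (x i) c)%:E * placement s (i :: u)) else 0) +
  \sum_(i <oo | i \notin u) (monom (x i) c)%:E *
    (\sum_(k <oo | k \notin i :: u) (monom (x k) d)%:E * placement s (k :: i :: u)).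
  have S i : 0 <= \sum_(k <oo | k \notin i :: u)
      (monom (x k) d)%:E * placement s (k :: i :: u).
    exact: nneseries_ge0.
  have H :
    \sum_(i <oo | i \notin u) (monom (x i) c)%:E * placement (d :: s) (i :: u) =
    (if cweight d == 1%N then \sum_(i <oo | i \notin u)
     (monom y d)%:E * ((monom (x i) c)%:E * placement s (i :: u)) else 0) +
     \sum_(i <oo | i \notin u) (monom (x i) c)%:E *
    (\sum_(k <oo | k \notin i :: u) (monom (x k) d)%:E * placement s (k :: i :: u)).
    under eq_eseriesr do rewrite placementE.
    case: ifP => _.
      rewrite -nneseriesD; last 2 first.
      - by move=> *; rewrite mule_ge0.
      - by move=> *; rewrite mule_ge0.
      apply: eq_eseriesr => i _; rewrite ge0_muleDr ?mule_ge0 //.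
      by congr (_ + _); rewrite muleCA.
    by rewrite add0e; apply: eq_eseriesr => i _; rewrite add0e.
  rewrite placementE H addeA; congr (_ + _); congr (_ + _) => //.
  rewrite placementE; case: ifP => _ /=; last by rewrite adde0.
  rewrite ge0_muleDr //; last 2 first.
  - by case: ifP => // _; rewrite mule_ge0.
  - exact: nneseries_ge0.
  congr (_ + _); first by case: ifP => _; rewrite ?mule0 ?muleA.
  by rewrite nneseriesZl.
rewrite (E a b) (E b a) (placement_cross a b); congr (_ + _).
rewrite -addeA [X in _ + X]addeC addeA; congr (_ + _ + _).
by rewrite andbC; case: ifP => // _; rewrite (muleC (monom y a)%:E).
Qed.

Lemma placement_cons a s t : (forall u, placement s u = placement t u) ->
  forall u, placement (a :: s) u = placement (a :: t) u.
Proof.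
move=> st u; rewrite !placementE; congr (_ + _); first by case: ifP => // _; rewrite st.
by apply: eq_eseriesr => i _; rewrite st.
Qed.

Lemma placement_rem a s u : a \in s -> placement s u = placement (a :: rem a s) u.
Proof.
elim: s u => [//|b s IH] u; rewrite in_cons eq_sym /=.
case: eqP => [->//|_ /= as_].
rewrite placement_swap; apply: placement_cons => v; exact: IH.
Qed.

Lemma placement_perm s t u : perm_eq s t -> placement s u = placement t u.
Proof.
elim: s t u => [|a s IH] t u st.
  by move: st; rewrite perm_sym => /perm_nilP ->.
have at_ : a \in t by rewrite -(perm_mem st) mem_head.
rewrite (placement_rem u at_); apply: placement_cons => v; apply: IH.
by rewrite -(perm_cons a) (perm_trans st) // perm_to_rem.
Qed.

Hypothesis x_fin : forall j, \sum_(i <oo) (x i 0 j)%:E < +oo.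

Definition free_mass j u := (y 0 j)%:E + \sum_(i <oo | i \notin u) (x i 0 j)%:E.

Lemma free_mass_fin j u : free_mass j u \is a fin_num.
Proof.
have S0 : 0 <= \sum_(i <oo | i \notin u) (x i 0 j)%:E.
  by apply: nneseries_ge0 => i _ _; rewrite lee_fin.
rewrite ge0_fin_numE; last by rewrite adde_ge0 // lee_fin.
rewrite lte_add_pinfty ?ltry //; apply: le_lt_trans (x_fin j).
by apply: subset_lee_nneseries => // i _; rewrite lee_fin.
Qed.

Lemma free_mass_cons j u i : i \notin u ->
  free_mass j u = (x i 0 j)%:E + free_mass j (i :: u).
Proof.
move=> iu; rewrite /free_mass addeCA; congr (_ + _).
rewrite (@nneseriesD1 _ _ i (fun k => k \notin u)) //; last first.
  by move=> k _; rewrite lee_fin.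
by congr (_ + _); apply: eq_eseriesl => k; rewrite in_cons negb_or andbC.
Qed.

(** A further point of color [j] either is a new block or joins one of the
    placed blocks. By induction on [s]: once the block [a] is in box [i], the
    free boxes account for [free_mass j (i :: u)], and the missing weight
    [x i 0 j] is that of the point joining [a]. As the vector 0 does not occur
    in [s], a block that has received a point is never dust. *)
Lemma placement_color j s u : cvec0 q \notin s ->
  placement (cunit j :: s) u + \sum_(b <- s) placement (cadd b j :: rem b s) u =
  free_mass j u * placement s u.
Proof.
elim: s u => [|a s IH] u.
  rewrite big_nil adde0 placementE -cadd0 cweight_cadd cweight0 eqxx.
  rewrite !placement_nil !mule1.
  rewrite cadd0 monom_unit /free_mass => _; congr (_ + _).
  by apply: eq_eseriesr => i _; rewrite placement_nil mule1 monom_unit.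
rewrite in_cons negb_or => /andP[a0 s0].
have {}IH v : placement (cunit j :: s) v +
    \sum_(b <- s) placement (cadd b j :: rem b s) v =
  free_mass j v * placement s v by exact: IH.
pose bump_sum v := \sum_(b <- s) placement (cadd b j :: rem b s) v.
have bump_ge0 v : 0 <= bump_sum v.
  by apply: sume_ge0 => *; exact: placement_ge0.
rewrite placement_swap big_cons /= eqxx.
have -> : \sum_(b <- s) placement (cadd b j :: rem b (a :: s)) u =
    (if cweight a == 1%N then (monom y a)%:E * bump_sum u else 0) +
    \sum_(i <oo | i \notin u) (monom (x i) a)%:E * bump_sum (i :: u).
  transitivity (\sum_(b <- s) placement (a :: cadd b j :: rem b s) u).
    rewrite big_seq [RHS]big_seq; apply: eq_bigr => b bs.
    rewrite placement_swap /=; case: eqP => [->|_]; last by [].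
    by apply: placement_cons => v; apply: placement_rem.
  under eq_bigr do rewrite placementE.
  rewrite big_split /=; congr (_ + _).
    by case: ifP => _; [rewrite -ge0_sume_distrr|rewrite big1].
  under eq_bigr do rewrite eseries_mkcond.
  rewrite -nneseries_sum; last by move=> b i _; case: ifP.
  rewrite [RHS]eseries_mkcond; apply: eq_eseriesr => i _.
  by case: ifP => _; [rewrite ge0_sume_distrr|rewrite big1].
rewrite (placementE a (cunit j :: s)) (@placement_nodust (cadd a j)); last first.
  by rewrite cweight_cadd eqSS cweight_eq0 eq_sym a0.
under [X in _ + (X + _) = _]eq_eseriesr do rewrite monom_cadd EFinM -muleA.
rewrite [X in _ + _ + X]addeCA addeACA (placementE a s).
rewrite [RHS]ge0_muleDr; last 2 first.
- by case: ifP => // _; rewrite mule_ge0.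
- exact: nneseries_ge0.
congr (_ + _).
  case: ifP => _; last by rewrite mule0 adde0.
  by rewrite muleCA -IH -ge0_muleDr.
have tail_ge0 i v : 0 <= (monom (x i) a)%:E * ((x i 0 j)%:E * placement s v).
  by rewrite mule_ge0 // mule_ge0 // lee_fin.
rewrite -nneseriesD; [|by []|by move=> *; rewrite mule_ge0].
rewrite -nneseriesD; [|by []|by move=> *; rewrite adde_ge0 // mule_ge0].
(* The factor has to be finite to be moved into the series. *)
rewrite -(fineK (free_mass_fin j u)) -nneseriesZl //.
apply: eq_eseriesr => i iu; rewrite (fineK (free_mass_fin j u)).
have fa_ge0 : 0 <= free_mass j (i :: u) * placement s (i :: u).
  by rewrite -IH adde_ge0 //; exact: bump_ge0.
have xa_ge0 : 0 <= (x i 0 j)%:E * placement s (i :: u).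
  by rewrite mule_ge0 // lee_fin.
rewrite addeCA -ge0_muleDr // IH -ge0_muleDr //.
rewrite muleCA; congr (_ * _); rewrite (free_mass_cons j iu).
have f_ge0 : 0 <= free_mass j (i :: u).
  by rewrite /free_mass adde_ge0 ?lee_fin // nneseries_ge0 // => *; rewrite lee_fin.
by rewrite [RHS]ge0_muleDl // lee_fin.
Qed.

(** The order of the blocks does not matter, so [a] may be placed first, and then
    every term has a vanishing factor. *)
Lemma placement_eq0 a s u j : a \in s -> (0 < a j)%N ->
  (forall i, i \notin u -> (monom (x i) a = 0)%R) ->
  (cweight a = 1%N -> (y 0 j = 0)%R) -> placement s u = 0.
Proof.
move=> as_ aj xa ya; rewrite (placement_rem u as_) placementE.
rewrite eseries0 => [|i _ iu]; last by rewrite xa // mul0e.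
by case: eqP => [/ya y0|_]; rewrite ?(monom_eq0 aj) // ?mul0e addr0.
Qed.

End AssignmentSums.

Lemma eq_placement_dust (R : realType) (q : nat) (y y' : 'rV[R]_q) (x : nat -> 'rV[R]_q)
    (s : seq (cvec q)) (u : seq nat) :
  (forall k, cunit k \in s -> y 0 k = y' 0 k) -> placement y x s u = placement y' x s u.
Proof.
elim: s u => [//|a s IH] u yy'.
have {}IH v : placement y x s v = placement y' x s v.
  by apply: IH => k ks; apply: yy'; rewrite in_cons ks orbT.
rewrite !placementE; congr (_ + _)%E; last by apply: eq_eseriesr => i _; rewrite IH.
case: cweight_unitP => // -[k ak]; rewrite IH ak !monom_unit yy' //.
by rewrite ak mem_head.
Qed.

(** * Adding and removing one point of a partition *)

Section Multisets.
Variable q : nat.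
Implicit Types (A B : cpart q) (a b n : cvec q) (j k : 'I_q).
Local Open Scope nat_scope.
Local Open Scope mset_scope.

Lemma perm_enum_msetD1 a A : perm_eq (a +` A) (a :: A).
Proof.
apply/allP => b _ /=; rewrite !count_mem_mset mset1DE.
by rewrite (eq_sym a).
Qed.

Lemma perm_enum_msetB1 b A : b \in A -> perm_eq (A `\ b) (rem b A).
Proof.
move=> bA; have := perm_enum_msetD1 b (A `\ b); rewrite msetB1K // perm_sym => pA.
by rewrite -(perm_cons b) (perm_trans pA) // perm_to_rem.
Qed.

Lemma mset_ind (Pr : cpart q -> Prop) :
  Pr mset0 -> (forall a A, Pr A -> Pr (a +` A)) -> forall A, Pr A.
Proof.
move=> P0 PD A; rewrite -(seq_mset_id A).
elim: (enum_mset A) => [|a s IH]; last by rewrite mset_cons; exact: PD.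
suff -> : seq_mset [::] = mset0 :> cpart q by [].
by apply/msetP => b; rewrite mset_seqE mset0E.
Qed.

Definition ccount A j := \sum_(a <- finsupp A) A a * a j.

Lemma ccountE A j : ccount A j = \sum_(a <- A) a j.
Proof. by rewrite [RHS]sum_mset. Qed.

Lemma csizeE A : csize A = \sum_(a <- A) cweight a.
Proof. by rewrite [RHS]sum_mset. Qed.

Lemma ccountD1 a A j : ccount (a +` A) j = a j + ccount A j.
Proof. by rewrite !ccountE (perm_big _ (perm_enum_msetD1 a A)) big_cons. Qed.

Lemma csizeD1 a A : csize (a +` A) = cweight a + csize A.
Proof. by rewrite !csizeE (perm_big _ (perm_enum_msetD1 a A)) big_cons. Qed.

Lemma ccount0 j : ccount mset0 j = 0.
Proof. by rewrite ccountE big_mset0. Qed.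

Lemma csize0 : csize (mset0 : cpart q) = 0.
Proof. by rewrite csizeE big_mset0. Qed.

Lemma csize_ccount A : csize A = \sum_j ccount A j.
Proof.
rewrite csizeE; under [RHS]eq_bigr do rewrite ccountE.
by rewrite exchange_big.
Qed.

Definition color_vector A : cvec q := [ffun j => ccount A j].

Lemma chromatic_byP n A :
  chromatic_by n A <-> cvec0 q \notin A /\ color_vector A = n.
Proof.
split=> [[A0 An]|[A0 <-]]; split=> //; last by move=> j; rewrite ffunE.
by apply/ffunP => j; rewrite ffunE -An.
Qed.

Lemma color_vector_by n A : chromatic_by n A -> color_vector A = n.
Proof. by move=> /chromatic_byP[]. Qed.

Lemma csize_color_vector A : csize A = cweight (color_vector A).
Proof. by rewrite csize_ccount; apply: eq_bigr => j _; rewrite ffunE. Qed.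

Lemma chromatic_by_csize n A : chromatic_by n A -> csize A = cweight n.
Proof. by move=> /chromatic_byP[_ <-]; exact: csize_color_vector. Qed.

Lemma chromatic_by_chromatic n A : chromatic_by n A -> chromatic (cweight n) A.
Proof. by move=> An; split; [case: An|exact: chromatic_by_csize]. Qed.

Lemma ccount_ge A a j : a \in A -> a j <= ccount A j.
Proof. by move=> /msetB1K <-; rewrite ccountD1 leq_addr. Qed.

Lemma block_of_color A j : 0 < ccount A j -> exists2 a, a \in A & 0 < a j.
Proof.
move=> Aj; apply: contrapT => H; move: Aj; rewrite ccountE big_seq big1 // => a aA.
by apply/eqP; rewrite -leqn0 leqNgt; apply/negP => aj; apply: H; exists a.
Qed.

Lemma color_vectorD1 a A j : color_vector (a +` A) j = a j + color_vector A j.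
Proof. by rewrite !ffunE ccountD1. Qed.

(** The number of permutations of [csize A] colored points that preserve the
    colors and a division into blocks of type [A]: they permute points of equal
    color within a block, and equal blocks. *)
Definition block_factor A := \prod_(a <- finsupp A) (cfact a ^ A a * (A a)`!).

Lemma block_factor_fsub (S : {fset cvec q}) A : (finsupp A `<=` S)%fset ->
  block_factor A = \prod_(a <- S) (cfact a ^ A a * (A a)`!).
Proof.
move=> AS; rewrite /block_factor; apply: big_fset_incl => // a _.
by rewrite memNfinsupp => /eqP ->.
Qed.

Lemma block_factor_gt0 A : 0 < block_factor A.
Proof.
apply: prodn_gt0 => a; rewrite muln_gt0 fact_gt0 andbT.
by rewrite expn_gt0 cfact_gt0.
Qed.

Lemma block_factor0 : block_factor mset0 = 1.
Proof. by rewrite /block_factor finsupp0 big_seq_fset0. Qed.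

Lemma block_factorD1 a A : block_factor (a +` A) = (A a).+1 * cfact a * block_factor A.
Proof.
rewrite (@block_factor_fsub (finsupp (a +` A)) A); last first.
  by apply/fsubsetP => b; rewrite !msuppE in_mset1D orbC => ->.
have aA : a \in finsupp (a +` A) by rewrite msuppE mset1D1.
rewrite /block_factor (big_fsetD1 a) //= [in RHS](big_fsetD1 a) //=.
rewrite mset1DE eqxx add1n expnS factS.
rewrite [RHS]mulnA; congr (_ * _); first by rewrite mulnACA [cfact a * _]mulnC.
by apply: eq_big_seq => b; rewrite !inE mset1DE => /andP[/negbTE ->].
Qed.

(** The value [b = 0] opens a new block: as [0] is not in [B], subtracting it
    has no effect. *)
Definition bump B b j : cpart q := cadd b j +` (B `\ b).

Lemma bump0 B j : cvec0 q \notin B -> bump B (cvec0 q) j = cunit j +` B.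
Proof. by move=> B0; rewrite /bump cadd0 mem_msetD1. Qed.

Lemma bump_mem B b j : cadd b j \in bump B b j.
Proof. by rewrite mset1D1. Qed.

Lemma color_vector_bump B b j : cvec0 q \notin B -> b \in cvec0 q :: finsupp B ->
  color_vector (bump B b j) = cadd (color_vector B) j.
Proof.
move=> B0; rewrite in_cons msuppE => bB; apply/ffunP => k.
rewrite color_vectorD1 !caddE.
case/orP: bB => [/eqP->|bB]; first by rewrite mem_msetD1 // ffunE add0n addnC.
by rewrite -[in RHS](msetB1K bB) color_vectorD1 addnAC.
Qed.

Lemma bump_no0 B b j : cvec0 q \notin B -> cvec0 q \notin bump B b j.
Proof.
move=> B0; rewrite in_mset1D negb_or eq_sym cadd_neq0 /=.
by apply: contra B0 => /(msubset_subset (msubsetDl B [mset b])).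
Qed.

Lemma chromatic_by_bump n B b j : chromatic_by n B ->
  b \in cvec0 q :: finsupp B -> chromatic_by (cadd n j) (bump B b j).
Proof.
move=> /chromatic_byP[B0 <-] bB; apply/chromatic_byP; split.
  exact: bump_no0.
exact: color_vector_bump.
Qed.

Lemma remove_bump B b j : cvec0 q \notin B -> b \in cvec0 q :: finsupp B ->
  remove (bump B b j) (cadd b j) j = B.
Proof.
move=> B0; rewrite /remove cadd_eq_unit in_cons msuppE.
case: (b =P cvec0 q) => [-> _|_ /= bB]; first by rewrite bump0 // cadd0 msetD1K.
by rewrite caddK msetD1K msetB1K.
Qed.

Lemma bump_remove A a j : cvec0 q \notin A -> a \in A -> 0 < a j ->
  bump (remove A a j) (cpred a j) j = A.
Proof.
move=> A0 aA aj; rewrite /bump /remove cpredK //.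
case: eqP => [E|_]; last by rewrite msetD1K msetB1K.
rewrite [cpred a j](_ : _ = cvec0 q); last by rewrite E -cadd0 caddK.
rewrite [_ `\ cvec0 q]mem_msetD1 ?msetB1K //.
by apply: contra A0 => /(msubset_subset (msubsetDl A [mset a])).
Qed.

Lemma mem_remove A a j : a \in A -> 0 < a j ->
  cpred a j \in cvec0 q :: finsupp (remove A a j).
Proof.
move=> aA aj; rewrite in_cons msuppE /remove.
case: (a =P cunit j) => [->|_]; first by rewrite -cadd0 caddK eqxx.
by rewrite mset1D1 orbT.
Qed.

Lemma remove_no0 A a j : cvec0 q \notin A -> a \in A -> 0 < a j ->
  cvec0 q \notin remove A a j.
Proof.
move=> A0 aA aj; rewrite /remove; case: ifPn => [_|aj1].
  by apply: contra A0 => /(msubset_subset (msubsetDl A [mset a])).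
rewrite in_mset1D negb_or; apply/andP; split.
  rewrite eq_sym; apply: contra aj1 => /eqP E.
  by rewrite -(cpredK aj) E cadd0.
by apply: contra A0 => /(msubset_subset (msubsetDl A [mset a])).
Qed.

Lemma chromatic_by_remove n A a j : chromatic_by n A -> a \in A -> 0 < a j ->
  chromatic_by (cpred n j) (remove A a j).
Proof.
move=> /chromatic_byP[A0 <-] aA aj; apply/chromatic_byP.
have R0 := remove_no0 A0 aA aj; split=> //.
have := color_vector_bump j R0 (mem_remove aA aj).
by rewrite bump_remove // => ->; rewrite caddK.
Qed.

Lemma chromatic_by0 : chromatic_by (cvec0 q) = [set mset0].
Proof.
apply/seteqP; split=> [A AA|_ ->] /=; last first.
  apply/chromatic_byP; split; first by rewrite in_mset0.
  by apply/ffunP => j; rewrite !ffunE ccount0.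
have [A0 /ffunP cA] := (chromatic_byP _ _).1 AA.
have [//|[a aA]] := mset_0Vmem A.
have [j aj] := @cvec_neq0P _ a (memPn A0 a aA).
by have := leq_trans aj (ccount_ge j aA); move: (cA j); rewrite !ffunE => ->.
Qed.

(** Every partition with color counts [n + e_j] arises by adding a point to one
    of the finitely many blocks of a partition with counts [n]. *)
Lemma finite_chromatic_by n : finite_set (chromatic_by n).
Proof.
elim/cvec_ind: n => [|n j IH].
  by rewrite chromatic_by0; exact: finite_set1.
apply: (@sub_finite_set _ _ (\bigcup_(B in chromatic_by n)
  (fun b => bump B b j) @` [set` cvec0 q :: finsupp B])); last first.
  by apply: bigcup_finite => // B _; apply: finite_image; exact: finite_seq.
move=> A AA; have A0 : cvec0 q \notin A by case: AA.
have nj : 0 < ccount A j by case: AA => _ /(_ j); rewrite /ccount cadd_diag => ->.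
have [a aA aj] := block_of_color nj.
exists (remove A a j).
  by have := chromatic_by_remove AA aA aj; rewrite caddK.
by exists (cpred a j); [exact: mem_remove|exact: bump_remove].
Qed.

(** For fixed [A] and [B], removing a point from [a] and adding a point to [b]
    are inverse bijections between the blocks involved. *)
Lemma big_remove_bump (T : Type) (idx : T) (op : Monoid.com_law idx) A B j
    (G : cvec q -> T) : cvec0 q \notin A -> cvec0 q \notin B ->
  \big[op/idx]_(a <- finsupp A | (0 < a j) && (B == remove A a j)) G a =
  \big[op/idx]_(b <- cvec0 q :: finsupp B | A == bump B b j) G (cadd b j).
Proof.
move=> A0 B0; rewrite -big_filter -[RHS]big_filter.
rewrite -(big_map (fun b => cadd b j) xpredT G); apply: perm_big.
have caddI : injective (fun b : cvec q => cadd b j).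
  exact: (@can_inj _ _ _ (fun b => cpred b j)) (fun b => caddK b j).
apply: uniq_perm.
- by rewrite filter_uniq // fset_uniq.
- rewrite (map_inj_uniq caddI) filter_uniq //= fset_uniq andbT msuppE.
  exact: B0.
move=> a; rewrite mem_filter msuppE; apply/idP/mapP => [|[b]].
  move=> /andP[/andP[aj /eqP ->] aA]; exists (cpred a j); last by rewrite cpredK.
  by rewrite mem_filter bump_remove // eqxx mem_remove.
rewrite mem_filter => /andP[/eqP -> bB] ->.
by rewrite cadd_diag remove_bump // eqxx bump_mem.
Qed.

(** The number of points of color [j] in [A] whose removal leaves [B]. *)
Definition removals j A B :=
  \sum_(a <- finsupp A | (0 < a j) && (B == remove A a j)) a j * A a.

(** The number of blocks of [B] of shape [b]; a new block can be opened in just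
    one way. *)
Definition bump_mult B b := if b == cvec0 q then 1 else B b.

(** Double counting: the [bump_mult] ways to enter [A := bump B b j] from [B]
    against the points of [A] whose removal leads back to [B]. *)
Lemma block_factor_bump B b j : cvec0 q \notin B -> b \in cvec0 q :: finsupp B ->
  bump_mult B b * block_factor (bump B b j) =
  (b j).+1 * bump B b j (cadd b j) * block_factor B.
Proof.
move=> B0; rewrite in_cons msuppE /bump_mult.
case: eqP => [-> _|_ /= bB].
  rewrite bump0 // block_factorD1 cadd0 cfact_unit mset1DE eqxx ffunE mul1n muln1.
  by rewrite mul1n.
rewrite /bump block_factorD1 mset1DE eqxx cfact_cadd.
rewrite -[in RHS](msetB1K bB) block_factorD1 msetB1K //.
rewrite -[in LHS](msetB1K bB) mset1DE eqxx.
rewrite msetB1K //; set u := (_ `\ b) _; set v := (_ `\ b) _.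
by rewrite add1n !mulnA; congr (_ * _); rewrite -!mulnA; nia.
Qed.

(** Each of the [(n j).+1] points of color [j] leads to exactly one [B]. *)
Lemma sum_removals n A j : chromatic_by (cadd n j) A ->
  \sum_(B <- fset_set (chromatic_by n)) removals j A B = (n j).+1.
Proof.
move=> AA; have A0 : cvec0 q \notin A by case: AA.
rewrite /removals; under eq_bigr do rewrite big_mkcond.
rewrite exchange_big /= -cadd_diag -(proj2 AA j) big_seq [RHS]big_seq.
apply: eq_bigr => a; rewrite msuppE => aA.
have [aj|] := ltnP 0 (a j); last first.
  by rewrite leqn0 => /eqP ->; rewrite muln0; apply: big1.
rewrite (bigD1_seq (remove A a j)) ?fset_uniq //=; last first.
  rewrite in_fset_set ?inE; last exact: finite_chromatic_by.
  by have := chromatic_by_remove AA aA aj; rewrite caddK.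
rewrite eqxx big1 ?addn0 1?mulnC // => B /negbTE ->.
by [].
Qed.

End Multisets.

Lemma sum_chromatic_by (R : realType) (q : nat) (n : cvec q) (F : cpart q -> R) :
  \sum_(A \in chromatic_by n) F A = \sum_(A <- fset_set (chromatic_by n)) F A.
Proof. by rewrite fsbig_finite //; exact: finite_chromatic_by. Qed.

(** * Removing a point, and the law of the color counts *)

Section Paintbox.
Variables (R : realType) (q : nat) (y : 'rV[R]_q) (x : nat -> 'rV[R]_q).
Implicit Types (A B : cpart q) (n : cvec q) (j : 'I_q).
Hypothesis y_ge0 : forall j, 0 <= y 0 j.
Hypothesis x_ge0 : forall i j, 0 <= x i 0 j.

Local Open Scope ereal_scope.

(** [psi A x] with an arbitrary dust weight [y] in place of [x 0]. *)
Definition box_mass A : \bar R :=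
  ((csize A)`!%:R / (block_factor A)%:R)%:E * placement y x A [:: 0%N].

Lemma box_mass_ge0 A : 0 <= box_mass A.
Proof. by rewrite mule_ge0 ?placement_ge0 // lee_fin divr_ge0. Qed.

Lemma box_mass0 : box_mass mset0 = 1.
Proof.
by rewrite /box_mass enum_mset0 csize0 block_factor0 fact0 divr1 mule1.
Qed.

Lemma box_mass_eq0 A a j : a \in A -> (0 < a j)%N ->
  (forall i, (0 < i)%N -> (monom (x i) a = 0)%R) ->
  (cweight a = 1%N -> (y 0 j = 0)%R) -> box_mass A = 0.
Proof.
move=> aA aj xa ya; rewrite /box_mass (placement_eq0 y_ge0 x_ge0 aA aj) ?mule0 // => i.
by rewrite inE -lt0n => /xa.
Qed.

Hypothesis x_fin : forall j, \sum_(i <oo) (x i 0 j)%:E < +oo.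

Definition box_color j := free_mass y x j [:: 0%N].

Lemma box_color_fin j : box_color j \is a fin_num.
Proof. exact: free_mass_fin. Qed.

Lemma box_color_ge0 j : 0 <= box_color j.
Proof.
rewrite /box_color /free_mass adde_ge0 ?lee_fin // nneseries_ge0 // => *.
by rewrite lee_fin.
Qed.

(** Throwing one more point: [placement_color] lists the partitions [A] it can
    lead to, one for each block of [B] and one for a new block, and
    [block_factor_bump] matches the multinomial coefficients. *)
Lemma box_mass_removals n j B : chromatic_by n B ->
  \sum_(A <- fset_set (chromatic_by (cadd n j))) box_mass A * (removals j A B)%:R%:E =
  (cweight n).+1%:R%:E * (box_color j * box_mass B).
Proof.
move=> BB; have B0 : cvec0 q \notin B by case: BB.
pose s := cvec0 q :: finsupp B.
pose c : R := (((cweight n).+1)`!%:R / (block_factor B)%:R)%R.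
have Bs := chromatic_by_csize BB.
transitivity (\sum_(b <- s) box_mass (bump B b j) *
    (cadd b j j * bump B b j (cadd b j))%:R%:E).
  transitivity (\sum_(A <- fset_set (chromatic_by (cadd n j))) \sum_(b <- s)
      if A == bump B b j then box_mass A * (cadd b j j * A (cadd b j))%:R%:E else 0).
    rewrite big_seq [RHS]big_seq; apply: eq_bigr => A.
    rewrite in_fset_set; last exact: finite_chromatic_by.
    rewrite inE => AA; have A0 : cvec0 q \notin (A : cpart q) by case: AA.
    rewrite /removals big_remove_bump // natr_sum -sumEFin.
    rewrite ge0_sume_distrr => [|i _]; last by rewrite lee_fin.
    by rewrite big_mkcond.
  rewrite exchange_big /= big_seq [RHS]big_seq; apply: eq_bigr => b bs.
  rewrite (bigD1_seq (bump B b j)) ?fset_uniq //=; last first.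
    rewrite in_fset_set ?inE; last exact: finite_chromatic_by.
    exact: chromatic_by_bump.
  by rewrite eqxx big1 ?adde0 // => A /negbTE ->.
transitivity (c%:E * \sum_(b <- s)
    (bump_mult B b)%:R%:E * placement y x (bump B b j) [:: 0%N]).
  rewrite ge0_sume_distrr; last first.
    by move=> b _; rewrite mule_ge0 ?placement_ge0 // lee_fin.
  rewrite big_seq [RHS]big_seq; apply: eq_bigr => b bs.
  rewrite /box_mass muleAC !muleA -!EFinM; congr (_%:E * _).
  rewrite (chromatic_by_csize (chromatic_by_bump j BB bs)) cweight_cadd.
  have /(congr1 (fun m : nat => m%:R : R)) := block_factor_bump j B0 bs.
  have f0 A : ((block_factor A)%:R != 0 :> R)%R.
    by rewrite pnatr_eq0 -lt0n block_factor_gt0.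
  move=> E; rewrite !natrM in E.
  rewrite cadd_diag (natrM _ (b j).+1) /c mulrAC [RHS]mulrAC.
  apply/eqP; rewrite eqr_div //; apply/eqP.
  rewrite -!mulrA; congr (_ * _)%R; by rewrite E mulrA.
have -> : \sum_(b <- s) (bump_mult B b)%:R%:E * placement y x (bump B b j) [:: 0%N] =
    box_color j * placement y x B [:: 0%N].
  rewrite -placement_color //.
  rewrite big_cons /bump_mult eqxx mul1e bump0 //; congr (_ + _).
    exact/placement_perm/perm_enum_msetD1.
  rewrite big_mset big_seq [RHS]big_seq; apply: eq_bigr => b bB.
  rewrite (negbTE (memPn B0 _ _)) -?msuppE //.
  have bumpE : perm_eq (bump B b j) (cadd b j :: rem b B).
    rewrite (perm_trans (perm_enum_msetD1 _ _)) // perm_cons.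
    by rewrite perm_enum_msetB1 // -msuppE.
  rewrite Monoid.iteropE (placement_perm y_ge0 x_ge0 _ bumpE).
  elim: (B b) => [|m IH]; first by rewrite mul0e.
  rewrite /= -natr1 EFinD ge0_muleDl ?mul1e ?lee_fin // addeC IH.
  by [].
rewrite /box_mass Bs.
rewrite muleCA [RHS]muleCA; congr (_ * _).
rewrite muleA -EFinM; congr (_%:E * _).
by rewrite /c factS natrM mulrA.
Qed.

Definition box_colors : 'rV[R]_q := (\row_j fine (box_color j))%R.

Lemma box_colorsE j : (box_colors 0%R j)%:E = box_color j.
Proof. by rewrite mxE fineK // box_color_fin. Qed.

(** The color counts are multinomial. By induction on [n]: sum
    [box_mass_removals] over [B] and count with [sum_removals]. *)
Lemma box_mass_total n :
  \sum_(A <- fset_set (chromatic_by n)) box_mass A =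
  ((cweight n)`!%:R / (cfact n)%:R * monom box_colors n)%:E.
Proof.
elim/cvec_ind: n => [|n j IH].
  rewrite chromatic_by0 fset_set1 big_seq_fset1 box_mass0 cweight0 cfact0 divr1.
  by rewrite mul1r monom0.
have : ((n j).+1)%:R%:E * \sum_(A <- fset_set (chromatic_by (cadd n j))) box_mass A =
   (cweight n).+1%:R%:E *
     (box_color j * \sum_(B <- fset_set (chromatic_by n)) box_mass B).
  rewrite ge0_sume_distrr; last by move=> *; exact: box_mass_ge0.
  rewrite ge0_sume_distrr; last by move=> *; exact: box_mass_ge0.
  rewrite ge0_sume_distrr; last first.
    by move=> *; rewrite mule_ge0 ?box_color_ge0 // box_mass_ge0.
  transitivity (\sum_(B <- fset_set (chromatic_by n))
     \sum_(A <- fset_set (chromatic_by (cadd n j))) box_mass A * (removals j A B)%:R%:E).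
    rewrite exchange_big /= big_seq [RHS]big_seq; apply: eq_bigr => A.
    rewrite in_fset_set ?inE; last exact: finite_chromatic_by.
    move=> AA; rewrite -ge0_sume_distrr; last by move=> *; rewrite lee_fin.
    by rewrite sumEFin -natr_sum sum_removals // muleC.
  rewrite big_seq [RHS]big_seq; apply: eq_bigr => B.
  rewrite in_fset_set ?inE; last exact: finite_chromatic_by.
  exact: box_mass_removals.
rewrite {}IH -box_colorsE -!EFinM => E.
have n0 : (((n j).+1)%:R != 0 :> R)%R by [].
have := congr1 (mule (((n j).+1)%:R^-1)%:E) E.
rewrite muleA -[in LHS]EFinM mulVf // mul1e => ->; rewrite -!EFinM.
rewrite cweight_cadd monom_cadd cfact_cadd factS; congr _%:E.
rewrite (natrM _ (cweight n).+1) (natrM _ (n j).+1); field.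
by rewrite pnatr_eq0 -lt0n cfact_gt0 addrC natr1 pnatr_eq0.
Qed.

End Paintbox.

(** * The functions [phi] and [psi] as placement sums *)

Section EsumExtra.
Variable R : realType.
Local Open Scope ereal_scope.

Lemma esumZl (T : choiceType) (S : set T) (f : T -> \bar R) (c : R) :
  (0 <= c)%R -> (forall i, 0 <= f i) ->
  \esum_(i in S) (c%:E * f i) = c%:E * \esum_(i in S) f i.
Proof.
move=> c0 f0; rewrite /esum -ereal_supZl //; last first.
  by apply/set0P; exists (\sum_(i \in set0) f i), set0 => //; exact: fsets_set0.
congr ereal_sup; apply/seteqP; split=> [_ [X SX <-]|_ [_ [X SX <-] <-]].
  by exists (\sum_(i \in X) f i); [exists X|rewrite ge0_mule_fsumr].
by exists X => //; rewrite ge0_mule_fsumr.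
Qed.

Lemma esum_nneseries (T : choiceType) (P : pred nat) (f : T -> nat -> \bar R) :
  (forall t i, 0 <= f t i) ->
  \esum_(t in [set: T]) \sum_(i <oo | P i) f t i =
  \sum_(i <oo | P i) \esum_(t in [set: T]) f t i.
Proof.
move=> f0; rewrite nneseries_esum => [|i _]; last by rewrite esum_ge0.
under eq_esum => t _ do rewrite nneseries_esum //.
rewrite esum_esum // [RHS]esum_esum //.
rewrite (reindex_esum ([set x | P x] `*`` (fun=> setT)) _ (fun p => (p.2, p.1))) //.
split=> [[i t] [Pi _]|[i1 t1] [i2 t2] _ _ [-> ->]|[t i] [_ Pi]] //.
by exists (i, t).
Qed.

End EsumExtra.

Section InjectiveSums.
Variables (R : realType) (q : nat) (x : nat -> 'rV[R]_q).
Implicit Types (a : cvec q) (s : seq (cvec q)) (u : seq nat).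
Hypothesis x_ge0 : forall i j, 0 <= x i 0 j.
Local Open Scope ereal_scope.

Let zero_ge0 j : (0 <= (0 : 'rV[R]_q) 0 j)%R.
Proof. by rewrite mxE. Qed.

Lemma placement_dust0 a s u : placement 0%R x (a :: s) u =
  \sum_(i <oo | i \notin u) (monom (x i) a)%:E * placement 0%R x s (i :: u).
Proof.
rewrite placementE; case: cweight_unitP => [[j ->]|_]; last by rewrite add0e.
by rewrite monom_unit mxE mul0e add0e.
Qed.

Let inj_outside (n : nat) u := [set iota : {ffun 'I_n -> nat} |
  injective iota /\ forall h, iota h \notin u].

Let ffun_cons (n : nat) (p : nat * {ffun 'I_n -> nat}) : {ffun 'I_n.+1 -> nat} :=
  [ffun h => if unlift ord0 h is Some k then p.2 k else p.1].

Let ffun_cons0 n p : @ffun_cons n p ord0 = p.1.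
Proof. by rewrite ffunE unlift_none. Qed.

Let ffun_consS n p k : @ffun_cons n p (lift ord0 k) = p.2 k.
Proof. by rewrite ffunE liftK. Qed.

Let ffun_cons_bij n u : set_bij
  ([set i | i \notin u] `*`` (fun i => @inj_outside n (i :: u)))
  (@inj_outside n.+1 u) (@ffun_cons n).
Proof.
split=> [[i f] /= [iu [fI fu]]|[i1 f1] [i2 f2] _ _ E|f [fI fu]].
- split=> [h1 h2|h].
    case: (unliftP ord0 h1) => [k1|] ->; case: (unliftP ord0 h2) => [k2|] ->;
      rewrite ?ffun_cons0 ?ffun_consS //=.
    + by move=> /fI ->.
    + by move=> E; have := fu k1; rewrite E mem_head.
    + by move=> E; have := fu k2; rewrite -E mem_head.
  case: (unliftP ord0 h) => [k|] ->; rewrite ?ffun_cons0 ?ffun_consS //=.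
  by have := fu k; rewrite in_cons negb_or => /andP[].
- congr pair.
    by have := congr1 (fun f : {ffun 'I_n.+1 -> nat} => f ord0) E; rewrite !ffun_cons0.
  apply/ffunP => k.
  have := congr1 (fun f : {ffun 'I_n.+1 -> nat} => f (lift ord0 k)) E.
  by rewrite !ffun_consS.
exists (f ord0, [ffun k => f (lift ord0 k)]).
  split=> /=; first exact: fu.
  split=> [k1 k2|k]; first by rewrite !ffunE => /fI/lift_inj.
  rewrite ffunE in_cons negb_or fu andbT.
  by apply/eqP => /fI/(congr1 val).
apply/ffunP => h; case: (unliftP ord0 h) => [k|] ->.
  by rewrite ffun_consS ffunE.
by rewrite ffun_cons0.
Qed.

Lemma esum_injective s u :
  \esum_(iota in [set iota : {ffun 'I_(size s) -> nat} |
                   injective iota /\ forall h, iota h \notin u])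
    (\prod_h monom (x (iota h)) (nth (cvec0 q) s h))%:E = placement 0%R x s u.
Proof.
elim: s u => [|a s IH] u.
  rewrite [X in esum X](_ : _ = [set [ffun => 0%N]]); last first.
    apply/seteqP; split=> [f _|_ ->] /=; first by apply/ffunP => -[].
    by split=> [[]|[]].
  rewrite esum_set1 ?lee_fin; last by apply: prodr_ge0 => -[].
  by rewrite big_ord0.
rewrite placement_dust0 nneseries_esum; last first.
  by move=> i _; rewrite mule_ge0 ?lee_fin ?monom_ge0 // placement_ge0.
rewrite (reindex_esum _ _ _ _ (@ffun_cons_bij (size s) u)).
have p_ge0 (f : {ffun 'I_(size s) -> nat}) :
    (0 <= \prod_h monom (x (f h)) (nth (cvec0 q) s h))%R.
  by apply: prodr_ge0 => h _; exact: monom_ge0.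
transitivity (\esum_(k in [set i | i \notin u] `*``
    (fun i => @inj_outside (size s) (i :: u)))
   (monom (x k.1) a)%:E * (\prod_h monom (x (k.2 h)) (nth (cvec0 q) s h))%:E).
  apply: eq_esum => p _; rewrite big_ord_recl ffun_cons0 -EFinM /=.
  by congr (_ * _)%:E; apply: eq_bigr => h _; rewrite ffun_consS.
rewrite -(esum_esum (a := fun i (f : {ffun 'I_(size s) -> nat}) => (monom (x i) a)%:E *
  (\prod_h monom (x (f h)) (nth (cvec0 q) s h))%:E)); last first.
  by move=> i f _ _; rewrite mule_ge0 // lee_fin // monom_ge0.
by apply: eq_esum => i _; rewrite esumZl ?monom_ge0 ?IH.
Qed.

End InjectiveSums.

Section Dust.
Variable q : nat.
Implicit Types (A : cpart q) (m : cvec q) (k : 'I_q).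
Local Open Scope nat_scope.
Local Open Scope mset_scope.

Lemma dustE m a : dust m a = \sum_k (if a == cunit k then m k else 0).
Proof.
have -> : \sum_k (if a == cunit k then m k else 0) =
    \sum_k (msetn (m k) (cunit k) : cpart q) a.
  by apply: eq_bigr => k _; rewrite msetnE.
apply: (big_morph (fun B : cpart q => B a)); first by move=> B C; rewrite msetE2.
by rewrite mset0E.
Qed.

Lemma cunit_inj : injective (@cunit q).
Proof.
move=> j k /ffunP/(_ j); rewrite !ffunE eqxx.
by case: (j =P k).
Qed.

Lemma dust_unit m k : dust m (cunit k) = m k.
Proof.
rewrite dustE (bigD1 k) //= eqxx big1 ?addn0 // => i ik.
by case: eqP => // /cunit_inj E; rewrite E eqxx in ik.
Qed.

Lemma dust_nounit m a : cweight a != 1 -> dust m a = 0.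
Proof.
move=> a1; rewrite dustE big1 // => i _; case: eqP => // E.
by case/cweight_unitP: a1; exists i.
Qed.

Lemma dust_cadd m k : dust (cadd m k) = cunit k +` dust m.
Proof.
apply/msetP => a; rewrite mset1DE; have [|a1] := boolP (cweight a == 1).
  move=> /cweight_unitP[j ->]; rewrite !dust_unit caddE addnC; congr (_ + _).
  by rewrite (inj_eq cunit_inj).
rewrite !dust_nounit // addn0; case: eqP => // E; case/cweight_unitP: a1.
by exists k.
Qed.

Lemma dust0 : dust (cvec0 q) = mset0.
Proof.
apply/msetP => a; rewrite dustE mset0E big1 // => j _; rewrite ffunE.
by case: ifP.
Qed.

Lemma dust_sub m A : (dust m `<=` A) = [forall k, m k <= A (cunit k)].
Proof.
apply/msubsetP/forallP => [H k|H a]; first by rewrite -(dust_unit m).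
have [|a1] := boolP (cweight a == 1); last by rewrite dust_nounit.
by move=> /cweight_unitP[j ->]; rewrite dust_unit.
Qed.

(** The number of ways to declare [m k] of the one-point blocks of color [k] in
    [A] to be dust, for all [k]. *)
Definition dust_choices A m := \prod_k 'C(A (cunit k), m k).

Lemma dust_choices_gt0 A m : (0 < dust_choices A m) = (dust m `<=` A).
Proof.
rewrite dust_sub; apply/idP/forallP => [H k|H].
  by rewrite -bin_gt0; apply: contraTT H; rewrite -!eqn0Ngt => /eqP E;
    rewrite /dust_choices (bigD1 k) //= E.
by apply: prodn_gt0 => k; rewrite bin_gt0.
Qed.

Lemma dust_choices0 A : dust_choices A (cvec0 q) = 1.
Proof. by rewrite /dust_choices big1 // => k _; rewrite ffunE bin0. Qed.

Lemma dust_choices_nounit a A m : cweight a != 1 ->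
  dust_choices (a +` A) m = dust_choices A m.
Proof.
move=> a1; apply: eq_bigr => k _; rewrite mset1DE; case: eqP => // E.
by case/cweight_unitP: a1; exists k.
Qed.

Lemma dust_choices_pascal k A m : dust_choices (cunit k +` A) m =
  dust_choices A m + (if 0 < m k then dust_choices A (cpred m k) else 0).
Proof.
rewrite /dust_choices (bigD1 k) //= [in RHS](bigD1 k) //=.
have -> : \prod_(i < q | i != k) 'C((cunit k +` A) (cunit i), m i) =
    \prod_(i < q | i != k) 'C(A (cunit i), m i).
  by apply: eq_bigr => i /negbTE ik; rewrite mset1DE (inj_eq cunit_inj) ik.
rewrite mset1DE eqxx add1n; case: ltnP => [mk|]; last first.
  by rewrite leqn0 => /eqP ->; rewrite !bin0 addn0.
have -> : \prod_i 'C(A (cunit i), cpred m k i) =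
    'C(A (cunit k), (m k).-1) * \prod_(i < q | i != k) 'C(A (cunit i), m i).
  rewrite (bigD1 k) //= cpredE eqxx subn1; congr (_ * _).
  by apply: eq_bigr => i /negbTE ik; rewrite cpredE ik subn0.
rewrite -mulnDl; congr (_ * _).
by case: (m k) mk => // l _; rewrite binS.
Qed.

Lemma csize_dust m A : dust m `<=` A -> csize (A `\` dust m) = csize A - cweight m.
Proof.
move=> /msetBDKC E; rewrite -[in RHS]E; move: (A `\` _) => B.
elim/cvec_ind: m {E} => [|m k IH].
  by rewrite dust0 mset0D cweight0 subn0.
rewrite dust_cadd -msetDA csizeD1 cweight_cadd -cadd0 cweight_cadd cweight0.
by rewrite add1n subSS.
Qed.

(** One-point blocks have [cfact = 1], so that only the factorials of their
    multiplicities change: [N! = 'C(N, m) * m! * (N - m)!] for each color. *)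
Lemma block_factor_dust m A : dust m `<=` A ->
  block_factor A = dust_choices A m * cfact m * block_factor (A `\` dust m).
Proof.
move=> /msetBDKC E; rewrite -[in LHS]E -[in dust_choices _ _]E; move: (A `\` _) => B.
elim/cvec_ind: m {E} => [|m k IH].
  by rewrite dust0 mset0D dust_choices0 cfact0 !mul1n.
rewrite dust_cadd -msetDA block_factorD1 IH cfact_unit cfact_cadd muln1.
set Y := dust m `+` B.
suff E : (Y (cunit k)).+1 * dust_choices Y m =
    dust_choices (cunit k +` Y) (cadd m k) * (m k).+1.
  by rewrite !mulnA E.
rewrite /dust_choices (bigD1 k) //= [in RHS](bigD1 k) //=.
rewrite mset1DE eqxx add1n cadd_diag.
have -> : \prod_(i < q | i != k) 'C((cunit k +` Y) (cunit i), cadd m k i) =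
    \prod_(i < q | i != k) 'C(Y (cunit i), m i).
  apply: eq_bigr => i /negbTE ik; rewrite mset1DE (inj_eq cunit_inj) ik.
  by rewrite caddE ik addn0.
by rewrite mulnA (mul_bin_diag (Y (cunit k)).+1) -mulnA mulnC.
Qed.

Lemma finite_dust_sub A : finite_set [set m | dust m `<=` A].
Proof.
pose N := \sum_k A (cunit k).
pose f (g : {ffun 'I_q -> 'I_N.+1}) : cvec q := [ffun k => g k : nat].
apply: (@sub_finite_set _ _ (f @` [set: {ffun 'I_q -> 'I_N.+1}])); last first.
  by apply: finite_image; exact: finite_finset.
move=> m /=; rewrite dust_sub => /forallP H.
exists [ffun k => inord (m k)] => //; apply/ffunP => k; rewrite !ffunE inordK //.
by rewrite ltnS (leq_trans (H k)) // /N (bigD1 k) //= leq_addr.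
Qed.

End Dust.

Section DustExpansion.
Variables (R : realType) (q : nat) (y : 'rV[R]_q) (x : nat -> 'rV[R]_q).
Implicit Types (A B : cpart q) (m : cvec q) (u : seq nat).
Hypothesis y_ge0 : forall j, 0 <= y 0 j.
Hypothesis x_ge0 : forall i j, 0 <= x i 0 j.

Local Open Scope ereal_scope.

Let zero_ge0 j : (0 <= (0 : 'rV[R]_q) 0 j)%R.
Proof. by rewrite mxE. Qed.

Let coef A m : R := ((dust_choices A m)%:R * monom y m)%R.

Let coef_ge0 A m : (0 <= coef A m)%R.
Proof. by rewrite mulr_ge0 // monom_ge0. Qed.

Let term_ge0 A B m u : 0 <= (coef A m)%:E * placement 0%R x B u.
Proof. by rewrite mule_ge0 ?placement_ge0 // lee_fin. Qed.

Let placement0_msetD1 a A u : placement 0%R x (a +` A)%mset u =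
  \sum_(i <oo | i \notin u) (monom (x i) a)%:E * placement 0%R x A (i :: u).
Proof.
by rewrite (placement_perm zero_ge0 x_ge0 u (perm_enum_msetD1 a A)) placement_dust0.
Qed.

Let dust_step a A u :
  \esum_(m in [set: cvec q])
     (coef A m)%:E * placement 0%R x ((a +` A) `\` dust m)%mset u =
  \sum_(i <oo | i \notin u) (monom (x i) a)%:E *
     \esum_(m in [set: cvec q])
       (coef A m)%:E * placement 0%R x (A `\` dust m)%mset (i :: u).
Proof.
transitivity (\esum_(m in [set: cvec q]) \sum_(i <oo | i \notin u)
    (monom (x i) a)%:E * ((coef A m)%:E * placement 0%R x (A `\` dust m)%mset (i :: u))).
  apply: eq_esum => m _; have [dA|] := boolP (dust m `<=` A)%mset.
    rewrite -msetDBA // placement0_msetD1 -nneseriesZl; last first.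
      by move=> i _; rewrite mule_ge0 ?placement_ge0 // lee_fin monom_ge0.
    by apply: eq_eseriesr => i _; rewrite muleCA.
  rewrite -dust_choices_gt0 -eqn0Ngt => /eqP E.
  rewrite /coef E mul0r mul0e eseries0 // => i _ _.
  by rewrite mul0e mule0.
rewrite esum_nneseries; last first.
  by move=> m i; rewrite mule_ge0 // lee_fin monom_ge0.
by apply: eq_eseriesr => i _; rewrite esumZl ?monom_ge0.
Qed.

(** Place the blocks one at a time. For a one-point block of color [k], Pascal's
    rule for [dust_choices] separates the choices in which it falls into a box
    from those in which it is dust; in the latter [m] is shifted by [e_k]. *)
Let placement_dust_coef A u :
  placement y x A u =
  \esum_(m in [set: cvec q]) (coef A m)%:E * placement 0%R x (A `\` dust m)%mset u.
Proof.
elim/mset_ind: A u => [|a A IH] u.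
  rewrite enum_mset0; rewrite (esumID [set cvec0 q]) //.
  rewrite setTI esum_set1 // dust0 msetB0 enum_mset0 !placement_nil /coef.
  rewrite dust_choices0 monom0 mulr1 mule1.
  rewrite esum1 ?adde0 // => m [_ m0].
  have [k mk] : exists k, (0 < m k)%N by apply: cvec_neq0P; exact/eqP.
  suff -> : dust_choices mset0 m = 0%N by rewrite mul0r mul0e.
  apply/eqP; rewrite eqn0Ngt dust_choices_gt0 dust_sub; apply/forallP => /(_ k).
  by rewrite mset0E leqNgt mk.
rewrite (placement_perm y_ge0 x_ge0 u (perm_enum_msetD1 a A)) placementE.
have -> : \sum_(i <oo | i \notin u) (monom (x i) a)%:E * placement y x A (i :: u) =
    \esum_(m in [set: cvec q])
      (coef A m)%:E * placement 0%R x ((a +` A) `\` dust m)%mset u.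
  by rewrite dust_step; apply: eq_eseriesr => i _; rewrite IH.
case: ifPn => [/cweight_unitP[k ->]|a1]; last first.
  rewrite add0e; apply: eq_esum => m _.
  by rewrite /coef dust_choices_nounit.
pose rest m := (if (0 < m k)%N then coef A (cpred m k) * y 0 k else 0)%R.
have coefE m : coef (cunit k +` A)%mset m = (coef A m + rest m)%R.
  rewrite /coef dust_choices_pascal natrD mulrDl; congr (_ + _)%R; rewrite /rest.
  case: ltnP => [mk|]; last by rewrite mul0r.
  by rewrite -mulrA -monom_cadd cpredK.
have rest_ge0 m : (0 <= rest m)%R.
  by rewrite /rest; case: ifP => // _; rewrite mulr_ge0.
under [RHS]eq_esum => m _.
  rewrite coefE EFinD ge0_muleDl ?lee_fin //; over.
rewrite esumD //; last by move=> m _; rewrite mule_ge0 ?placement_ge0 // lee_fin.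
rewrite [RHS]addeC; congr (_ + _).
rewrite IH -esumZl ?monom_ge0 //.
rewrite [RHS](esumID [set m : cvec q | (0 < m k)%N]) //; last first.
  by move=> m _; rewrite mule_ge0 ?placement_ge0 // lee_fin.
rewrite !setTI [X in _ + X]esum1 ?adde0; last first.
  by move=> m /= /negP mk; rewrite /rest (negbTE mk) mul0e.
have bij : set_bij [set: cvec q] [set m : cvec q | (0 < m k)%N]
    (fun m => cadd m k).
  split=> [m _|m1 m2 _ _ /(congr1 (fun m => cpred m k))|m mk].
  - by change (0 < cadd m k k)%N; rewrite cadd_diag.
  - by rewrite !caddK.
  - by exists (cpred m k); rewrite // cpredK.
rewrite (reindex_esum _ _ _ _ bij).
apply: eq_esum => m _; rewrite /rest cadd_diag /= caddK monom_unit dust_cadd msetBDl.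
by rewrite EFinM muleA [(y 0%R k)%:E * _]muleC.
Qed.

Lemma placement_dust A u :
  placement y x A u =
  \esum_(m in [set: cvec q])
    ((dust_choices A m)%:R * monom y m)%:E * placement 0%R x (A `\` dust m)%mset u.
Proof. exact: placement_dust_coef. Qed.

End DustExpansion.

Section PsiFormula.
Variables (R : realType) (q : nat) (x : nat -> 'rV[R]_q).
Implicit Types (A B : cpart q) (m : cvec q).
Hypothesis x_ge0 : forall i j, 0 <= x i 0 j.
Local Open Scope ereal_scope.

Let zero_ge0 j : (0 <= (0 : 'rV[R]_q) 0 j)%R.
Proof. by rewrite mxE. Qed.

Lemma phiE A : phi A x = box_mass 0%R x A.
Proof.
rewrite /phi /box_mass; congr (_%:E * _).
  by rewrite prodfV -natr_prod.
have sE : perm_eq (blocks A) A by rewrite perm_sort.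
rewrite -(placement_perm zero_ge0 x_ge0 [:: 0%N] sE) -(esum_injective x_ge0).
congr esum; apply/seteqP; split=> f [fI f1]; split=> // h.
  by rewrite inE -lt0n f1.
by have := f1 h; rewrite inE lt0n.
Qed.

(** By [placement_dust], the sum over [m] in [psi] collects the placements in
    which exactly [m k] one-point blocks of color [k] are dust. *)
Lemma psiE A : psi A x = box_mass (x 0%N) x A.
Proof.
pose c : R := ((csize A)`!%:R / (block_factor A)%:R)%R.
have c0 : (0 <= c)%R by rewrite divr_ge0.
rewrite /box_mass -/c (placement_dust (x_ge0 0%N) x_ge0) -esumZl //; last first.
  move=> m; rewrite mule_ge0 ?placement_ge0 // lee_fin.
  by rewrite mulr_ge0 // monom_ge0.
rewrite (esumID [set m | (dust m `<=` A)%mset]) => [|m _]; last first.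
  rewrite mule_ge0 ?mule_ge0 ?placement_ge0 // lee_fin.
  by rewrite mulr_ge0 // monom_ge0.
rewrite !setTI [X in _ + X]esum1 ?adde0; last first.
  move=> m /= /negP; rewrite -dust_choices_gt0 -eqn0Ngt => /eqP ->.
  by rewrite mul0r mul0e mule0.
rewrite esum_fset; last 2 first.
- exact: finite_dust_sub.
- move=> m _; rewrite mule_ge0 ?mule_ge0 ?placement_ge0 // lee_fin.
  by rewrite mulr_ge0 // monom_ge0.
rewrite /psi ge0_mule_fsumr; last first.
  move=> m; rewrite mule_ge0 // ?lee_fin ?mulr_ge0 ?monom_ge0 //.
  by rewrite phiE box_mass_ge0.
apply: eq_fsbigr => m /[!inE] /= dA; rewrite phiE /box_mass.
rewrite !muleA -!EFinM; congr (_%:E * _).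
rewrite /c (block_factor_dust dA) csize_dust //.
have f0 (n : nat) : (0 < n)%N -> (n%:R != 0 :> R)%R by rewrite pnatr_eq0 lt0n.
have := f0 _ (fact_gt0 (csize A - cweight m)).
have := f0 _ (cfact_gt0 m); have := f0 _ (block_factor_gt0 (A `\` dust m)%mset).
have : ((dust_choices A m)%:R != 0 :> R)%R by rewrite f0 // dust_choices_gt0.
move: (csize A)`! (csize A - cweight m)`! (dust_choices A m) (cfact m) (block_factor _).
move=> f g d a b d0 b0 a0 g0; rewrite !natrM; field.
by rewrite d0 b0 a0 g0.
Qed.

End PsiFormula.

(** * Borel measurability on the space of paintboxes *)

Section BorelContinuous.

Lemma continuous_borel_preimage (T U : ptopologicalType) (f : T -> U) :
  continuous f -> forall B : set (borel U), measurable B ->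
  measurable (f @^-1` B : set (borel T)).
Proof.
move=> cf B mB.
suff : <<s (@open U) >> `<=` [set C | measurable (f @^-1` C : set (borel T))].
  exact.
apply: smallest_sub; last first.
  move=> V oV; apply: sub_sigma_algebra.
  by move/continuousP : cf => /(_ V oV).
split=> [|C mC|F mF] /=.
- by rewrite preimage_set0; exact: measurable0.
- by rewrite setTD preimage_setC; exact: measurableC.
- by rewrite preimage_bigcup; exact: bigcupT_measurable.
Qed.

Lemma continuous_borel_measurable (R : realType) (T : ptopologicalType)
    (f : T -> R) : continuous f -> measurable_fun [set: borel T] f.
Proof.
move=> cf; apply: (measurability _ (RGenOpens.measurableE R)).
move=> _ [_ [a [b ->]] <-]; rewrite setTI; apply: sub_sigma_algebra.
by move/continuousP : cf => /(_ _ (@interval_open _ (BRight a) (BLeft b) isT isT)).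
Qed.

End BorelContinuous.

Section Continuity.
Variables (R : realType) (T : topologicalType).

Lemma sum_continuous (I : Type) (r : seq I) (f : I -> T -> R) :
  (forall i, continuous (f i)) -> continuous (fun t => \sum_(i <- r) f i t).
Proof.
move=> cf t; elim: r => [|i r IH].
  under eq_fun do rewrite big_nil; exact: cst_continuous.
under eq_fun do rewrite big_cons.
by apply: continuousD; [exact: cf|exact: IH].
Qed.

(** The approximation error of [S N] is at most [1 - L N], and a bound on it at
    one point persists nearby as [L N] is continuous. *)
Lemma squeeze_continuous (D : T -> R) (S L : nat -> T -> R) :
  (forall N, continuous (S N)) -> (forall N, continuous (L N)) ->
  (forall t N, S N t <= D t <= S N t + (1 - L N t)) ->
  (forall t, L N t @[N --> \oo] --> (1 : R)) -> continuous D.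
Proof.
move=> cS cL SDL L1 t; apply/cvgrPdist_lt => e e0.
have e3 : 0 < e / 3 by rewrite divr_gt0.
have [N LN] : exists N, 1 - e / 3 < L N t.
  have /cvgrPdist_lt/(_ _ e3)[N _ /(_ N (leqnn N))] := L1 t.
  by move=> H; exists N; rewrite ltrBlDr -ltrBlDl; exact: le_lt_trans (ler_norm _) H.
near=> z.
have SN : `|S N t - S N z| < e / 3.
  by near: z; have /cvgrPdist_lt := cS N t; exact.
have LzN : 1 - e / 3 < L N z.
  by near: z; apply: (@cvgr_gt _ _ _ _ _ (L N t)) => //; exact: cL.
have /andP[t1 t2] := SDL t N; have /andP[z1 z2] := SDL z N.
move: SN; rewrite !ltr_norml => /andP[? ?].
by apply/andP; split; lra.
Unshelve. all: by end_near. Qed.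

Lemma continuous_rV (n : nat) (f : T -> 'rV[R]_n) :
  (forall j, continuous (fun t => f t 0 j)) -> continuous f.
Proof.
move=> cf t; apply/cvg_ballP => e e0.
have : \forall z \near t, forall j, ball (f t 0 j) e (f z 0 j).
  by apply: filter_forall => j; have /cvg_ballP/(_ e e0) := cf j t.
by apply: filterS => z tz; split=> // i j; rewrite ord1; exact: tz.
Qed.

End Continuity.

Section NablaTheory.
Variables (R : realType) (q : nat).
Implicit Types (x : nabla_type R q) (i : nat) (j : 'I_q.+1).

Lemma nabla_ge0 x i j : 0 <= nabla_seq x i 0 j.
Proof. by have /set_mem[H _ _] := svalP x; exact: H. Qed.

Lemma nabla_cvg x : series (fun i => l1norm (nabla_seq x i)) @ \oo --> (1 : R).
Proof. by have /set_mem[_ _ H] := svalP x; exact: H. Qed.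

Lemma nabla_le_l1 x i j : nabla_seq x i 0 j <= l1norm (nabla_seq x i).
Proof.
rewrite /l1norm (bigD1 j) //= ger0_norm ?nabla_ge0 // lerDl.
by apply: sumr_ge0.
Qed.

Lemma cvg_color x j : cvgn (series (fun i => nabla_seq x i 0 j)).
Proof.
apply: (@series_le_cvg _ _ (fun i => l1norm (nabla_seq x i))).
- by move=> i; exact: nabla_ge0.
- by move=> i; apply: sumr_ge0.
- by move=> i; exact: nabla_le_l1.
- by apply/cvg_ex; exists 1; exact: nabla_cvg.
Qed.

Lemma color_massE x j : (color_mass (nabla_seq x) 0 j)%:E =
  (\sum_(i <oo) (nabla_seq x i 0 j)%:E)%E.
Proof.
rewrite mxE -EFin_lim; last exact: cvg_color.
by apply: congr_lim; apply/funext => n /=; rewrite sumEFin.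
Qed.

Lemma nabla_fin x j : (\sum_(i <oo) (nabla_seq x i 0 j)%:E < +oo)%E.
Proof. by rewrite -color_massE ltry. Qed.

Lemma box_color_nabla x j :
  box_color (nabla_seq x 0%N) (nabla_seq x) j = (color_mass (nabla_seq x) 0 j)%:E.
Proof.
rewrite color_massE /box_color /free_mass (@nneseriesD1 _ _ 0%N xpredT) //; last first.
  by move=> k _; rewrite lee_fin nabla_ge0.
by congr (_ + _)%E; apply: eq_eseriesl => i; rewrite inE.
Qed.

Lemma color_mass_ge0 x j : 0 <= color_mass (nabla_seq x) 0 j.
Proof.
rewrite -lee_fin color_massE nneseries_ge0 // => i _ _.
by rewrite lee_fin nabla_ge0.
Qed.

Lemma color_mass_ge x i j : nabla_seq x i 0 j <= color_mass (nabla_seq x) 0 j.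
Proof.
rewrite -lee_fin color_massE (@nneseriesD1 _ _ i xpredT) //; last first.
  by move=> k _; rewrite lee_fin nabla_ge0.
by rewrite leeDl // nneseries_ge0 // => k _ _; rewrite lee_fin nabla_ge0.
Qed.

(** The tail of one color is at most the tail of all colors, and the total mass
    is 1. *)
Lemma color_mass_bounds x j N :
  series (fun i => nabla_seq x i 0 j) N <= color_mass (nabla_seq x) 0 j <=
  series (fun i => nabla_seq x i 0 j) N +
    (1 - series (fun i => l1norm (nabla_seq x i)) N).
Proof.
have nd : nondecreasing_seq (series (fun i => nabla_seq x i 0 j)).
  by apply/nondecreasing_series => i _ _; exact: nabla_ge0.
have ndl : nondecreasing_seq (series (fun i => l1norm (nabla_seq x i))).
  by apply/nondecreasing_series => i _ _; exact: sumr_ge0.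
have l1_le1 n : series (fun i => l1norm (nabla_seq x i)) n <= 1.
  rewrite -(cvg_lim (@Rhausdorff R) (nabla_cvg x)).
  by apply: nondecreasing_cvgn_le ndl _ _; apply/cvg_ex; exists 1; exact: nabla_cvg.
rewrite mxE (nondecreasing_cvgn_le nd (@cvg_color x j)) /=.
apply: limr_le; first exact: cvg_color.
near=> n; have Nn : (N <= n)%N by near: n; exact: nbhs_infty_ge.
have : series (fun i => nabla_seq x i 0 j) n - series (fun i => nabla_seq x i 0 j) N
    <= series (fun i => l1norm (nabla_seq x i)) n -
       series (fun i => l1norm (nabla_seq x i)) N.
  by rewrite !sub_series_geq //; apply: ler_sum => i _; exact: nabla_le_l1.
by have := l1_le1 n; lra.
Unshelve. all: by end_near. Qed.

Lemma nabla_coord_continuous i j :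
  continuous (fun x : nabla_type R q => nabla_seq x i 0 j).
Proof.
move=> x; rewrite /nabla_seq.
pose val_seq (y : nabla_type R q) : {ptws nat -> 'rV[R]_q.+1} := set_val y.
apply: (@continuous_comp _ _ _ (fun y => val_seq y i)
  (fun r : 'rV[R]_q.+1 => r 0 j)).
  apply: (@continuous_comp _ _ _ val_seq
    (fun f : {ptws nat -> 'rV[R]_q.+1} => f i)).
    exact: initial_continuous.
  exact: proj_continuous.
exact: coord_continuous.
Qed.

(** In the product topology a coordinate of the sum could lose mass in the
    limit; on [nabla] it cannot, since the total mass is 1 throughout. *)
Lemma color_mass_continuous :
  continuous (fun x : nabla_type R q => color_mass (nabla_seq x)).
Proof.
apply: continuous_rV => j.
apply: (@squeeze_continuous _ _ _
  (fun N x => series (fun i => nabla_seq x i 0 j) N)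
  (fun N x => series (fun i => l1norm (nabla_seq x i)) N)).
- by move=> N; apply: sum_continuous => i; exact: nabla_coord_continuous.
- move=> N; apply: sum_continuous => i; apply: sum_continuous => k z.
  apply: continuous_comp; first exact: nabla_coord_continuous.
  exact: norm_continuous.
- by move=> x N; exact: color_mass_bounds.
- by move=> x; exact: nabla_cvg.
Qed.

End NablaTheory.

Section MeasurableAssignment.
Context d (T : measurableType d) (R : realType) (q : nat).
Variables (Y : T -> 'rV[R]_q) (X : nat -> T -> 'rV[R]_q).
Hypothesis Y_ge0 : forall t j, 0 <= Y t 0 j.
Hypothesis X_ge0 : forall i t j, 0 <= X i t 0 j.
Hypothesis mY : forall j, measurable_fun setT (fun t => Y t 0 j).
Hypothesis mX : forall i j, measurable_fun setT (fun t => X i t 0 j).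

Lemma measurable_monom (Z : T -> 'rV[R]_q) (a : cvec q) :
  (forall j, measurable_fun setT (fun t => Z t 0 j)) ->
  measurable_fun setT (fun t => monom (Z t) a).
Proof.
move=> mZ; elim/cvec_ind: a => [|a j IH].
  by under eq_fun do rewrite monom0; exact: measurable_cst.
by under eq_fun do rewrite monom_cadd; exact: measurable_funM.
Qed.

Lemma measurable_placement (s : seq (cvec q)) (u : seq nat) :
  measurable_fun setT (fun t => placement (Y t) (fun i => X i t) s u).
Proof.
elim: s u => [|a s IH] u.
  by under eq_fun do rewrite placement_nil; exact: measurable_cst.
under eq_fun do rewrite placementE.
apply: emeasurable_funD.
  case: (cweight a == 1%N); last exact: measurable_cst.
  apply: emeasurable_funM => //; apply/measurable_EFinP; exact: measurable_monom.
under eq_fun => t do rewrite (@eq_eseriesl _ _ (fun i => i \in [predC u])) //.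
apply: ge0_emeasurable_sum => [i t _ _|i _].
  by rewrite mule_ge0 ?placement_ge0 // lee_fin monom_ge0.
apply: emeasurable_funM => //; apply/measurable_EFinP; exact: measurable_monom.
Qed.

Lemma measurable_box_mass (A : cpart q) :
  measurable_fun setT (fun t => box_mass (Y t) (fun i => X i t) A).
Proof. by apply: measurable_funeM; exact: measurable_placement. Qed.

End MeasurableAssignment.

(** * Integrated identities *)

Section IntegratedIdentities.
Variables (R : realType) (q : nat).
Notation T := (borel (nabla_type R q)).
Variables (mu : probability T R) (v : 'rV[R]_q.+1).
Hypothesis v_ge0 : forall j, 0 <= v 0 j.
Implicit Types (A B : cpart q.+1) (n : cvec q.+1).

#[local] Instance ae_mu_filter : Filter (almost_everywhere mu).
Proof. exact: (ae_filter_ringOfSetsType mu). Qed.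

Lemma integral_cst_prob (c : R) : (\int[mu]_x c%:E = c%:E)%E.
Proof.
rewrite integral_cst // [X in (_ * X)%E](_ : _ = 1%E) ?mule1 //.
exact: probability_setT.
Qed.

Lemma measurable_coord i j : measurable_fun [set: T] (fun x : T => nabla_seq x i 0 j).
Proof. by apply: continuous_borel_measurable; exact: nabla_coord_continuous. Qed.

Lemma measurable_color_mass j :
  measurable_fun [set: T] (fun x : T => color_mass (nabla_seq x) 0 j).
Proof.
apply: continuous_borel_measurable => x.
apply: (@continuous_comp _ _ _ (fun x : nabla_type R q => color_mass (nabla_seq x))
  (fun r : 'rV[R]_q.+1 => r 0 j)); first exact: color_mass_continuous.
exact: coord_continuous.
Qed.

(** For [v = 0] this is the dust of [x] itself. The vector [v] serves to give
    positive mass to the colors that [color_mass] does not charge. *)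
Definition extra_dust (x : T) : 'rV[R]_q.+1 := nabla_seq x 0%N + v.

Lemma extra_dust_ge0 x j : 0 <= extra_dust x 0 j.
Proof. by rewrite mxE addr_ge0 // nabla_ge0. Qed.

Definition shifted_mass A (x : T) := box_mass (extra_dust x) (nabla_seq x) A.

Lemma shifted_mass_ge0 A x : (0 <= shifted_mass A x)%E.
Proof.
by apply: box_mass_ge0; [exact: extra_dust_ge0|exact: nabla_ge0].
Qed.

Lemma measurable_shifted_mass A : measurable_fun [set: T] (shifted_mass A).
Proof.
apply: (@measurable_box_mass _ T R _ extra_dust (fun i (x : T) => nabla_seq x i)).
- exact: extra_dust_ge0.
- by move=> i x j; exact: nabla_ge0.
- move=> j; under eq_fun do rewrite mxE.
  by apply: measurable_funD; [exact: measurable_coord|exact: measurable_cst].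
- exact: measurable_coord.
Qed.

Lemma box_color_extra x j : box_color (extra_dust x) (nabla_seq x) j =
  (color_mass (nabla_seq x) 0 j + v 0 j)%:E.
Proof.
by rewrite EFinD -box_color_nabla /box_color /free_mass mxE EFinD addeAC.
Qed.

Lemma box_colors_extra x : box_colors (extra_dust x) (nabla_seq x) =
  color_mass (nabla_seq x) + v.
Proof. by apply/rowP => j; rewrite !mxE box_color_extra /= !mxE. Qed.

Definition mean_mass A : \bar R := (\int[mu]_x shifted_mass A x)%E.

Lemma mean_mass_ge0 A : (0 <= mean_mass A)%E.
Proof. by apply: integral_ge0 => x _; exact: shifted_mass_ge0. Qed.

Lemma mean_mass_total n : (\sum_(A <- fset_set (chromatic_by n)) mean_mass A =
  \int[mu]_x ((cweight n)`!%:R / (cfact n)%:R *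
     monom (color_mass (nabla_seq x) + v)%R n)%:E)%E.
Proof.
rewrite -ge0_integral_sum //; last 2 first.
- exact: measurable_shifted_mass.
- by move=> A x _; exact: shifted_mass_ge0.
apply: eq_integral => x _; rewrite -box_colors_extra.
apply: box_mass_total; [exact: extra_dust_ge0|exact: nabla_ge0|exact: nabla_fin].
Qed.

Variable p : 'rV[R]_q.+1.
Hypothesis p_ge0 : forall j, 0 <= p 0 j.
Hypothesis mass_p : {ae mu, forall x, color_mass (nabla_seq x) + v = p}.

Lemma mean_mass_total_cst n : (\sum_(A <- fset_set (chromatic_by n)) mean_mass A =
  ((cweight n)`!%:R / (cfact n)%:R * monom p n)%:E)%E.
Proof.
rewrite mean_mass_total (@ge0_ae_eq_integral _ _ _ mu _ _
  (fun=> ((cweight n)`!%:R / (cfact n)%:R * monom p n)%:E)) //.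
- exact: integral_cst_prob.
- apply/measurable_EFinP; apply: measurable_funM; first exact: measurable_cst.
  apply: measurable_monom => j; under eq_fun do rewrite mxE.
  by apply: measurable_funD; [exact: measurable_color_mass|exact: measurable_cst].
- move=> x _; rewrite lee_fin mulr_ge0 ?divr_ge0 // monom_ge0 // => j.
  by rewrite mxE addr_ge0 // color_mass_ge0.
- by move=> _ _; rewrite lee_fin mulr_ge0 ?divr_ge0 // monom_ge0.
by apply: filterS mass_p => x -> _.
Qed.

Lemma mean_mass_removals n j B : chromatic_by n B ->
  (\sum_(A <- fset_set (chromatic_by (cadd n j))) mean_mass A * (removals j A B)%:R%:E =
  (cweight n).+1%:R%:E * ((p 0 j)%:E * mean_mass B))%E.
Proof.
move=> BB.
transitivity (\sum_(A <- fset_set (chromatic_by (cadd n j)))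
    \int[mu]_x ((removals j A B)%:R%:E * shifted_mass A x))%E.
  apply: eq_bigr => A _; rewrite muleC ge0_integralZl_EFin //.
  - by move=> x _; exact: shifted_mass_ge0.
  - exact: measurable_shifted_mass.
rewrite -ge0_integral_sum //; last 2 first.
- by move=> A; apply: measurable_funeM; exact: measurable_shifted_mass.
- by move=> A x _; rewrite mule_ge0 ?lee_fin // shifted_mass_ge0.
rewrite muleA -EFinM -ge0_integralZl_EFin //; last 3 first.
- by move=> x _; exact: shifted_mass_ge0.
- exact: measurable_shifted_mass.
- by rewrite mulr_ge0.
have E x : (\sum_(A <- fset_set (chromatic_by (cadd n j)))
    ((removals j A B)%:R%:E * shifted_mass A x) =
    (cweight n).+1%:R%:E *
      (box_color (extra_dust x) (nabla_seq x) j * shifted_mass B x))%E.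
  rewrite -(box_mass_removals (@extra_dust_ge0 x) (@nabla_ge0 _ _ x)
    (@nabla_fin _ _ x) j BB).
  by apply: eq_bigr => A _; rewrite muleC.
apply: ge0_ae_eq_integral => //.
- by apply: emeasurable_sum => A; apply: measurable_funeM; exact: measurable_shifted_mass.
- by apply: measurable_funeM; exact: measurable_shifted_mass.
- by move=> x _; apply: sume_ge0 => A _; rewrite mule_ge0 ?lee_fin // shifted_mass_ge0.
- by move=> x _; rewrite mule_ge0 ?shifted_mass_ge0 // lee_fin mulr_ge0.
apply: filterS mass_p => x xp _; rewrite E box_color_extra muleA -EFinM -xp [in RHS]mxE.
by [].
Qed.

End IntegratedIdentities.

(** * One-color and multipartition structures *)

Section Support.
Variables (R : realType) (q : nat).
Implicit Types (a : cvec q) (z : 'rV[R]_q) (j k : 'I_q) (A : cpart q).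

Lemma prop_to_unitP z j : (forall k, 0 <= z 0 k) ->
  prop_to_unit z j <-> forall k, k != j -> z 0 k = 0.
Proof.
move=> z0; split=> [[c _ ->] k kj|zj].
  by rewrite !mxE eqxx (negbTE kj) mulr0.
exists (z 0 j) => //; apply/rowP => k; rewrite !mxE eqxx /=.
by have [->|/zj ->] := eqVneq k j; rewrite ?mulr1 ?mulr0.
Qed.

Lemma cscale_unitE a j : (forall k, k != j -> a k = 0%N) ->
  a = Defs.cscale (a j) (cunit j).
Proof.
move=> aj; apply/ffunP => k; rewrite !ffunE.
by have [->|/aj ->] := eqVneq k j; rewrite ?muln1 ?muln0.
Qed.

Lemma not_cscale_unit a j : (forall m, a <> Defs.cscale m (cunit j)) ->
  exists2 k, k != j & (0 < a k)%N.
Proof.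
move=> H; apply: contrapT => N; apply: (H (a j)); apply: cscale_unitE => k kj.
by apply/eqP; rewrite -leqn0 leqNgt; apply/negP => ak; apply: N; exists k.
Qed.

End Support.

Section OneAndMultiColor.
Variables (R : realType) (q : nat).
Variables (P : nat -> cpart q.+1 -> R).
Variable mu : probability (borel (nabla_type R q)) R.
Hypothesis hP : forall n, prob_on (chromatic n) (P n).
Hypothesis hmu : forall (n : nat) (A : cpart q.+1), chromatic n A ->
  (P n A)%:E = (\int[mu]_x psi A (nabla_seq x))%E.
Implicit Types (A B : cpart q.+1) (x : borel (nabla_type R q)).

#[local] Existing Instance ae_mu_filter.

Lemma extra_dust0 x : extra_dust 0 x = nabla_seq x 0%N.
Proof. by rewrite /extra_dust addr0. Qed.

Lemma shifted_mass0E A x : shifted_mass 0 A x = psi A (nabla_seq x).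
Proof. by rewrite psiE ?/shifted_mass ?extra_dust0 //; exact: nabla_ge0. Qed.

Lemma massE n A : chromatic n A -> (P n A)%:E = mean_mass mu 0 A.
Proof.
by move=> nA; rewrite hmu //; apply: eq_integral => x _; rewrite shifted_mass0E.
Qed.

Lemma mass_off n A : ~ chromatic n A -> P n A = 0.
Proof. by have [_ H _] := hP n; exact: H. Qed.

Let zero_ge0 j : 0 <= (0 : 'rV[R]_q.+1) 0 j.
Proof. by rewrite mxE. Qed.

Lemma mean_mass_eq0 (v : 'rV[R]_q.+1) A : (forall j, 0 <= v 0 j) ->
  {ae mu, forall x, shifted_mass v A x = 0%E} -> mean_mass mu v A = 0%E.
Proof.
move=> v0 H; rewrite /mean_mass (@ge0_ae_eq_integral _ _ _ mu _ _ (cst 0%E)) //.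
- by rewrite integral0.
- exact: measurable_shifted_mass.
- by move=> x _; exact: shifted_mass_ge0.
- by apply: filterS H => x.
Qed.

Lemma mass_eq0 n A : {ae mu, forall x, shifted_mass 0 A x = 0%E} -> P n A = 0.
Proof.
move=> H; have [nA|/mass_off//] := pselect (chromatic n A).
by apply: EFin_inj; rewrite massE // mean_mass_eq0.
Qed.

Lemma ae0_of_integral (f : borel (nabla_type R q) -> \bar R) :
  measurable_fun setT f -> (forall x, (0 <= f x)%E) ->
  (\int[mu]_x f x = 0)%E -> {ae mu, forall x, f x = 0%E}.
Proof.
move=> mf f0 If; have : (\int[mu]_x `|f x| = 0)%E.
  by rewrite -If; apply: eq_integral => x _; rewrite gee0_abs.
move/(ae_eq_integral_abs mu measurableT mf) => H.
by apply: filterS H => x; apply.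
Qed.

Lemma marginal_sum (n : cvec q.+1) :
  (\int[mu]_x ((cweight n)`!%:R / (cfact n)%:R * monom (color_mass (nabla_seq x)) n)%:E =
   (\sum_(A <- fset_set (chromatic_by n)) P (cweight n) A)%:E)%E.
Proof.
have := mean_mass_total mu zero_ge0 n; under [in RHS]eq_integral do rewrite addr0.
move=> <-; rewrite -sumEFin big_seq [RHS]big_seq; apply: eq_bigr => A.
rewrite in_fset_set ?inE; last exact: finite_chromatic_by.
by move=> /chromatic_by_chromatic nA; rewrite massE.
Qed.

Lemma color_mean j : (\int[mu]_x (color_mass (nabla_seq x) 0 j)%:E =
  (\sum_(A <- fset_set (chromatic_by (cunit j))) P 1 A)%:E)%E.
Proof.
have c1 : cweight (cunit j) = 1%N by apply/eqP/cweight_unitP; exists j.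
have := marginal_sum (cunit j); rewrite c1 cfact_unit factS fact0 mul1n divr1 => <-.
by apply: eq_integral => x _; rewrite mul1r monom_unit.
Qed.

Lemma ae_all_fin (I : finType) (Pr : I -> borel (nabla_type R q) -> Prop) :
  (forall i, {ae mu, forall x, Pr i x}) -> {ae mu, forall x, forall i, Pr i x}.
Proof. by move=> H; apply: filter_forall => i; exact: H. Qed.

Lemma standard_structureP : standard_structure P <->
  exists j : 'I_q.+1, {ae mu, forall x, forall i, prop_to_unit (nabla_seq x i) j}.
Proof.
split=> -[j Hj]; exists j.
  have D0 k : {ae mu, forall x, k != j -> color_mass (nabla_seq x) 0 k = 0}.
    have [->|kj] := eqVneq k j; first by apply: aeW => x.
    suff : {ae mu, forall x, (color_mass (nabla_seq x) 0 k)%:E = 0%E}.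
      by apply: filterS => x [->].
    apply: ae0_of_integral.
    - by apply/measurable_EFinP; exact: measurable_color_mass.
    - by move=> x; rewrite lee_fin color_mass_ge0.
    rewrite color_mean big_seq big1 // => A.
    rewrite in_fset_set ?inE; last exact: finite_chromatic_by.
    move=> AA; apply: Hj => /= -[_ H].
    have [a aA ak] : exists2 a, a \in (A : cpart q.+1) & (0 < a k)%N.
      by apply: block_of_color; rewrite /ccount; case: AA => _ ->; rewrite cunit_diag.
    have [m E] : exists m, a = Defs.cscale m (cunit j) by apply: H; rewrite msuppE.
    move: ak; rewrite E !ffunE (negbTE kj).
    by rewrite muln0.
  apply: filterS (ae_all_fin D0) => x Dx i.
  apply/prop_to_unitP => [k|k kj]; first exact: nabla_ge0.
  by apply/eqP; rewrite eq_le nabla_ge0 andbT -(Dx k kj) color_mass_ge.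
move=> n A nA; have [cA|/mass_off//] := pselect (chromatic n A).
have [a aA aj] : exists2 a, a \in A & forall m, a <> Defs.cscale m (cunit j).
  apply: contrapT => H; apply: nA; split=> // a; rewrite msuppE => aA.
  apply: contrapT => Na.
  by apply: H; exists a => // m E; apply: Na; exists m.
have [k kj ak] := not_cscale_unit aj.
apply: mass_eq0; apply: filterS Hj => x xj.
have x0 i : nabla_seq x i 0 k = 0.
  by have /prop_to_unitP := xj i; apply => // l; exact: nabla_ge0.
apply: (box_mass_eq0 _ _ aA ak).
- exact: extra_dust_ge0.
- exact: nabla_ge0.
- by move=> i _; exact: monom_eq0 ak _.
- by rewrite extra_dust0.
Qed.

(** Two points form the block [e_j + e_k] only by falling into the same box. *)
Lemma pair_block_zero j k : P 2 [mset cadd (cunit j) k]%mset = 0 ->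
  {ae mu, forall x, forall i, (1 <= i)%N ->
     nabla_seq x i 0 j * nabla_seq x i 0 k = 0}.
Proof.
pose a := cadd (cunit j) k; pose A : cpart q.+1 := [mset a]%mset.
rewrite -/a -/A => PA.
have a2 : cweight a = 2%N by rewrite cweight_cadd -cadd0 cweight_cadd cweight0.
have AE : A = (a +` mset0)%mset by rewrite msetD0.
have cA : chromatic 2 A.
  split; first by rewrite in_mset1 eq_sym cadd_neq0.
  by rewrite AE csizeD1 csize0 a2.
have : {ae mu, forall x, shifted_mass 0 A x = 0%E}.
  apply: ae0_of_integral; first exact: measurable_shifted_mass.
    by move=> x; exact: shifted_mass_ge0.
  by rewrite -[LHS](massE cA) PA.
apply: filterS => x + i i1; have eA : enum_mset A = [:: a] by rewrite /A enum_msetn.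
rewrite /shifted_mass /box_mass eA.
rewrite (placementE _ _ a) a2 /= add0e => /eqP; rewrite mule_eq0 => /orP[|].
  rewrite eqe mulf_eq0 invr_eq0 !pnatr_eq0.
  by rewrite !eqn0Ngt fact_gt0 block_factor_gt0.
have t_ge0 l : (0 <= (monom (nabla_seq x l) a)%:E * 1)%E.
  by rewrite mule1 lee_fin monom_ge0 //; exact: nabla_ge0.
rewrite (@nneseriesD1 _ _ i (fun l => l \notin [:: 0%N])) //; last by rewrite inE -lt0n.
rewrite padde_eq0 ?nneseries_ge0 // => /andP[+ _].
by rewrite mule1 eqe monom_cadd monom_unit => /eqP.
Qed.

Lemma multipartition_structureP : multipartition_structure P <->
  {ae mu, forall x, forall i, (1 <= i)%N ->
     exists j : 'I_q.+1, prop_to_unit (nabla_seq x i) j}.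
Proof.
split=> [HP|Hx].
  have D0 j : {ae mu, forall x, forall k, k != j -> forall i, (1 <= i)%N ->
      nabla_seq x i 0 j * nabla_seq x i 0 k = 0}.
    apply: ae_all_fin => k; have [->|kj] := eqVneq k j.
      by apply: aeW => x.
    suff P0 : P 2 [mset cadd (cunit j) k]%mset = 0.
      by apply: filterS (pair_block_zero P0) => x Hx _.
    apply: HP => -[_ /(_ (cadd (cunit j) k))]; rewrite msuppE mset11.
    move=> [//|m [l [_ /ffunP E]]].
    have jk : (j == k) = false by rewrite eq_sym (negbTE kj).
    have := E j; have := E k; rewrite !ffunE !eqxx (negbTE kj) jk.
    by case: (k =P l) => [<-|_]; rewrite ?jk ?muln0.
  apply: filterS (ae_all_fin D0) => x Dx i i1.
  have [[j xj]|H] := pselect (exists j, nabla_seq x i 0 j != 0).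
    exists j; apply/prop_to_unitP => [k|k kj]; first exact: nabla_ge0.
    have /eqP := Dx j k kj i i1; rewrite mulf_eq0 (negbTE xj) /=.
    by move=> /eqP.
  exists ord0; apply/prop_to_unitP => [k|k _]; first exact: nabla_ge0.
  by apply: contrapT => /eqP xk; apply: H; exists k.
move=> n A nA; have [cA|/mass_off//] := pselect (chromatic n A).
have [a aA aN] : exists2 a, a \in A &
    forall m k, (1 <= m <= n)%N -> a <> Defs.cscale m (cunit k).
  apply: contrapT => H; apply: nA; split=> // a; rewrite msuppE => aA.
  apply: contrapT => Na; apply: H; exists a => // m k mn E.
  by apply: Na; exists m, k.
have [A0 An] := cA.
have [k ak] := @cvec_neq0P _ a (memPn A0 a aA).
(* A block that is not of one color has two colors, so that no box of one color
   can hold it. *)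
have [j jk aj] : exists2 j, j != k & (0 < a j)%N.
  apply: contrapT => H; apply: (aN (a k) k).
    rewrite ak /= -An csize_ccount (leq_trans (ccount_ge k aA)) //.
    by rewrite (bigD1 k) //= leq_addr.
  apply: cscale_unitE => j jk; apply/eqP; rewrite -leqn0 leqNgt.
  by apply/negP => aj; apply: H; exists j.
apply: mass_eq0; apply: filterS Hx => x Hx.
apply: (box_mass_eq0 _ _ aA ak).
- exact: extra_dust_ge0.
- exact: nabla_ge0.
- move=> i /Hx[l /prop_to_unitP Hl].
  have {}Hl := Hl (fun k => nabla_ge0 x i k).
  have [E|kl] := eqVneq k l; last exact: monom_eq0 ak (Hl _ kl).
  by apply: monom_eq0 aj (Hl _ _); rewrite -E.
move=> /eqP/cweight_unitP[l E]; move: ak aj; rewrite E !ffunE.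
by case: (k =P l) => // <- _; rewrite (negbTE jk).
Qed.

End OneAndMultiColor.

(** * Structures of partially exchangeable type *)

Section PartialExchangeability.
Variables (R : realType) (q : nat).
Variables (P : nat -> cpart q.+1 -> R).
Variable mu : probability (borel (nabla_type R q)) R.
Hypothesis hP : forall n, prob_on (chromatic n) (P n).
Hypothesis hmu : forall (n : nat) (A : cpart q.+1), chromatic n A ->
  (P n A)%:E = (\int[mu]_x psi A (nabla_seq x))%E.
Implicit Types (A B : cpart q.+1) (x : borel (nabla_type R q)) (n m : cvec q.+1).

#[local] Existing Instance ae_mu_filter.

(** Of the measures mixed together only the one with the color counts of [A]
    charges [A]. *)
Lemma mixture_term (Q : cvec q.+1 -> cpart q.+1 -> R) (c : cvec q.+1 -> R) N A :
  (forall m, ~ chromatic_by m A -> Q m A = 0) ->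
  \sum_(m \in [set m : cvec q.+1 | cweight m = N]) c m * Q m A =
  if cweight (color_vector A) == N then c (color_vector A) * Q (color_vector A) A else 0.
Proof.
move=> Q0; have out m : m <> color_vector A -> c m * Q m A = 0.
  by move=> mA; rewrite Q0 ?mulr0 // => /color_vector_by E; exact: mA.
case: eqP => [E|NE].
  rewrite -(fsbig_widen [set color_vector A]) ?fsbig_set1 //.
    by move=> m /= ->.
  by move=> m [_ /= mA]; exact: out.
by apply: fsbig1 => m /= mN; apply: out => mA; apply: NE; rewrite -mA.
Qed.

Section Necessity.
Variables (p : 'rV[R]_q.+1) (Q : cvec q.+1 -> cpart q.+1 -> R).
Hypothesis hQ : forall n, prob_on (chromatic_by n) (Q n).
Hypothesis PQ : forall (N : nat) A, P N A =
  \sum_(m \in [set m : cvec q.+1 | cweight m = N])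
    (N`!%:R / (cfact m)%:R) * monom p m * Q m A.

Lemma mass_total n : \sum_(A <- fset_set (chromatic_by n)) P (cweight n) A =
  (cweight n)`!%:R / (cfact n)%:R * monom p n.
Proof.
have [_ _] := hQ n; rewrite sum_chromatic_by.
move=> /(congr1 (GRing.mul ((cweight n)`!%:R / (cfact n)%:R * monom p n))) E.
rewrite -[RHS]mulr1 -E mulr_sumr.
rewrite big_seq [RHS]big_seq; apply: eq_bigr => A.
rewrite in_fset_set ?inE; last exact: finite_chromatic_by.
move=> nA; rewrite PQ mixture_term => [|m mA]; last by have [_ + _] := hQ m; apply.
by rewrite (color_vector_by nA) eqxx.
Qed.

Lemma color_moment n :
  (\int[mu]_x ((cweight n)`!%:R / (cfact n)%:R * monom (color_mass (nabla_seq x)) n)%:E =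
  ((cweight n)`!%:R / (cfact n)%:R * monom p n)%:E)%E.
Proof. by rewrite (marginal_sum hmu) mass_total. Qed.

(** By [color_moment] for the counts [e_j] and [2 e_j], the coordinate [D j] has
    mean [p 0 j] and second moment [p 0 j ^+ 2], hence variance zero. *)
Lemma color_mass_ae : {ae mu, forall x, color_mass (nabla_seq x) = p}.
Proof.
pose D j x := color_mass (nabla_seq x) 0 j.
have D0 j x : 0 <= D j x by exact: color_mass_ge0.
have mD j : measurable_fun setT (D j) by exact: measurable_color_mass.
have m1 j : (\int[mu]_x (D j x)%:E = (p 0 j)%:E)%E.
  have c1 : cweight (cunit j) = 1%N by apply/eqP/cweight_unitP; exists j.
  have := color_moment (cunit j); rewrite c1 cfact_unit divr1 mul1r monom_unit => <-.
  by apply: eq_integral => x _; rewrite mul1r monom_unit.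
have m2 j : (\int[mu]_x (D j x ^+ 2)%:E = (p 0 j ^+ 2)%:E)%E.
  have := color_moment (cadd (cunit j) j).
  rewrite cweight_cadd cfact_cadd cfact_unit cunit_diag.
  have -> : cweight (cunit j) = 1%N by apply/eqP/cweight_unitP; exists j.
  rewrite divff ?pnatr_eq0 // mul1r monom_cadd monom_unit -expr2 => <-.
  by apply: eq_integral => x _; rewrite mul1r monom_cadd monom_unit -expr2.
have p0 j : 0 <= p 0 j.
  by rewrite -lee_fin -m1; apply: integral_ge0 => x _; rewrite lee_fin.
have Dp j : {ae mu, forall x, D j x = p 0 j}.
  have mV : measurable_fun setT (fun x => ((D j x - p 0 j) ^+ 2)%:E).
    by apply/measurable_EFinP; apply: measurable_funX; apply: measurable_funB.
  suff : {ae mu, forall x, ((D j x - p 0 j) ^+ 2)%:E = 0%E}.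
    apply: filterS => x [/eqP]; rewrite sqrf_eq0 subr_eq0.
    by move=> /eqP.
  apply: ae0_of_integral => // [x|]; first by rewrite lee_fin sqr_ge0.
  (* Adding [2 * p * D] makes both sides sums of nonnegative terms. *)
  have : (\int[mu]_x (((D j x - p 0 j) ^+ 2)%:E + (2 * p 0 j)%:E * (D j x)%:E) =
      \int[mu]_x ((D j x ^+ 2)%:E + (p 0 j ^+ 2)%:E))%E.
    by apply: eq_integral => x _; rewrite -!EFinM -!EFinD; congr _%:E; ring.
  rewrite ge0_integralD //; last 3 first.
  - by move=> x _; rewrite lee_fin sqr_ge0.
  - by move=> x _; rewrite -EFinM lee_fin mulr_ge0 // mulr_ge0.
  - by apply: measurable_funeM; apply/measurable_EFinP.
  rewrite ge0_integralZl_EFin //; last 3 first.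
  - by move=> x _; rewrite lee_fin.
  - by apply/measurable_EFinP.
  - by rewrite mulr_ge0.
  rewrite ge0_integralD //; last 3 first.
  - by move=> x _; rewrite lee_fin sqr_ge0.
  - by apply/measurable_EFinP; apply: measurable_funX.
  - by move=> x _; rewrite lee_fin sqr_ge0.
  rewrite m1 m2 integral_cst_prob -EFinM -EFinD.
  have -> : 2 * p 0 j * p 0 j = p 0 j ^+ 2 + p 0 j ^+ 2 by ring.
  have : (0 <= \int[mu]_x ((D j x - p 0 j) ^+ 2)%:E)%E.
    by apply: integral_ge0 => x _; rewrite lee_fin sqr_ge0.
  case: (\int[mu]_x _)%E => // r _ [] /eqP.
  by rewrite -[X in _ == X]add0r (inj_eq (addIr _)) => /eqP ->.
apply: filterS (ae_all_fin Dp) => x Dx.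
by apply/rowP => j; exact: Dx.
Qed.

End Necessity.

(** The point [p] is closed, so its complement is a Borel set. *)
Lemma ae_pushforward (p : 'rV[R]_q.+1) :
  {ae mu, forall x, color_mass (nabla_seq x) = p} <->
  forall B : set (borel 'rV[R]_q.+1), measurable B ->
    pushforward mu (fun x => color_mass (nabla_seq x) : borel 'rV[R]_q.+1) B
      = dirac (p : borel 'rV[R]_q.+1) B.
Proof.
pose D x : borel 'rV[R]_q.+1 := color_mass (nabla_seq x).
have mD (B : set (borel 'rV[R]_q.+1)) : measurable B -> measurable (D @^-1` B).
  exact: (continuous_borel_preimage (@color_mass_continuous R q)).
split=> [Dp B mB|H].
  have null (C : set (borel 'rV[R]_q.+1)) : p \notin C -> measurable C ->
      mu (D @^-1` C) = 0%E.
    move=> pC mC; apply: (negligibleP mu (mD _ mC)).1.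
    apply: negligibleS Dp => x /= Cx Dxp; move/negP: pC; apply.
    by rewrite -Dxp inE.
  rewrite /pushforward diracE; have [pB|/null->//] := boolP (p \in B).
  have pNB : p \notin ~` B by apply/negP => /set_mem; apply; exact: set_mem pB.
  have := probability_setC mu (mD _ (measurableC mB)).
  rewrite (null _ pNB (measurableC mB)).
  by rewrite preimage_setC setCK sube0.
have mNp : measurable (~` [set p] : set (borel 'rV[R]_q.+1)).
  apply: sub_sigma_algebra; rewrite openC.
  exact: accessible_closed_set1 (hausdorff_accessible (@norm_hausdorff _ _)) _.
have := H _ mNp; rewrite /pushforward diracE.
rewrite (_ : (p \in _) = false); last first.
  by apply/negP => /set_mem /(_ erefl).
by move=> mu0; exact: (negligibleP mu (mD _ mNp)).2 mu0.
Qed.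

Section Sufficiency.
Variable p : 'rV[R]_q.+1.
Hypothesis p_simplex : unit_simplex p.
Hypothesis mass_p : {ae mu, forall x, color_mass (nabla_seq x) = p}.

Let p_ge0 j : 0 <= p 0 j.
Proof. by have [/(_ j)/andP[]] := p_simplex. Qed.

(** The extra dust makes the total mass [p'] of every color positive. *)
Let v : 'rV[R]_q.+1 := \row_j (p 0 j == 0)%:R.
Let p' := p + v.

Let v_ge0 j : 0 <= v 0 j.
Proof. by rewrite mxE. Qed.

Let p'_gt0 j : 0 < p' 0 j.
Proof.
rewrite !mxE; case: eqP => [->|/eqP pj]; first by rewrite add0r ltr01.
by rewrite addr0 lt_neqAle eq_sym pj p_ge0.
Qed.

Let p'_ge0 j : 0 <= p' 0 j.
Proof. exact: ltW. Qed.

Let mass_p' : {ae mu, forall x, color_mass (nabla_seq x) + v = p'}.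
Proof. by apply: filterS mass_p => x ->. Qed.

Let binom n : R := (cweight n)`!%:R / (cfact n)%:R.
Let W n : R := binom n * monom p' n.

Let monom_gt0 n : 0 < monom p' n.
Proof. by apply: prodr_gt0 => j _; exact: exprn_gt0. Qed.

Let binom_gt0 n : 0 < binom n.
Proof. by rewrite divr_gt0 // ltr0n ?fact_gt0 ?cfact_gt0. Qed.

Let W_gt0 n : 0 < W n.
Proof. exact: mulr_gt0. Qed.

Definition cond_mass n A : R :=
  if `[< chromatic_by n A >] then fine (mean_mass mu v A) / W n else 0.

Let EW n : (\sum_(A <- fset_set (chromatic_by n)) mean_mass mu v A = (W n)%:E)%E.
Proof. exact: (mean_mass_total_cst v_ge0 p'_ge0 mass_p'). Qed.

Let E_fin n A : chromatic_by n A -> mean_mass mu v A \is a fin_num.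
Proof.
move=> nA; rewrite ge0_fin_numE ?mean_mass_ge0 //.
apply: le_lt_trans (ltry (W n)); rewrite -EW.
rewrite (bigD1_seq A) ?fset_uniq //=; last first.
  by rewrite in_fset_set ?inE //; exact: finite_chromatic_by.
by rewrite leeDl // sume_ge0 // => B _; exact: mean_mass_ge0.
Qed.

Let cond_massE n A : chromatic_by n A -> (cond_mass n A * W n)%:E = mean_mass mu v A.
Proof.
move=> nA; rewrite /cond_mass asboolT // divfK ?gt_eqF // fineK //.
exact: E_fin nA.
Qed.

Lemma cond_mass_prob n : prob_on (chromatic_by n) (cond_mass n).
Proof.
split=> [A|A nA|].
- rewrite /cond_mass; case: asboolP => // _.
  by rewrite divr_ge0 ?fine_ge0 ?mean_mass_ge0 // ltW.
- by rewrite /cond_mass asboolF.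
rewrite sum_chromatic_by; apply: (mulIf (lt0r_neq0 (W_gt0 n))).
rewrite mul1r mulr_suml; apply: EFin_inj; rewrite -EW -sumEFin.
rewrite big_seq [RHS]big_seq; apply: eq_bigr => A.
rewrite in_fset_set ?inE; last exact: finite_chromatic_by.
exact: cond_massE.
Qed.

Lemma cond_mass_consistent n j B : chromatic_by n B ->
  cond_mass n B = \sum_(A \in chromatic_by (cadd n j))
     cond_mass (cadd n j) A * sample_color R (cadd n j) j A B.
Proof.
move=> nB.
have sE A : sample_color R (cadd n j) j A B = (removals j A B)%:R / (n j).+1%:R.
  by rewrite /sample_color /removals natr_sum mulr_suml cadd_diag.
rewrite sum_chromatic_by.
have := mean_mass_removals v_ge0 p'_ge0 mass_p' j nB.
rewrite -(cond_massE nB) big_seq.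
under eq_bigr => A.
  rewrite in_fset_set ?inE; last exact: finite_chromatic_by.
  move=> nA; rewrite -(cond_massE nA) -EFinM; over.
rewrite -big_seq sumEFin => -[E].
have n0 : (n j).+1%:R != 0 :> R by [].
have Wn : W (cadd n j) = (cweight n).+1%:R * p' 0 j * W n / (n j).+1%:R.
  rewrite /W /binom cweight_cadd cfact_cadd monom_cadd factS.
  rewrite (natrM _ (cweight n).+1) (natrM _ (n j).+1); field.
  by rewrite pnatr_eq0 -lt0n cfact_gt0 addrC natr1 pnatr_eq0.
under eq_bigr do rewrite sE mulrA.
rewrite -mulr_suml; apply: (mulIf (lt0r_neq0 (W_gt0 (cadd n j)))).
transitivity ((\sum_(A <- fset_set (chromatic_by (cadd n j)))
   cond_mass (cadd n j) A * W (cadd n j) * (removals j A B)%:R) / (n j).+1%:R).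
  by rewrite E Wn; field.
rewrite mulrAC; congr (_ / _); rewrite mulr_suml; apply: eq_bigr => A _.
by rewrite mulrAC.
Qed.

Lemma cond_mass_exchangeable : partially_exchangeable cond_mass.
Proof.
split; first exact: cond_mass_prob.
by move=> n j B nj nB; rewrite (cond_mass_consistent j nB) cpredK.
Qed.

(** If [A] contains a color [k] with [p 0 k = 0], both sides vanish; otherwise the
    extra dust has no color of [A], so that it changes neither the mass of [A]
    nor the monomial. *)
Lemma mixture_cond_mass N A : P N A =
  \sum_(m \in [set m : cvec q.+1 | cweight m = N])
    (N`!%:R / (cfact m)%:R) * monom p m * cond_mass m A.
Proof.
rewrite mixture_term => [|m mA]; last by rewrite /cond_mass asboolF.
have [NA|NA] := pselect (chromatic N A); last first.
  rewrite (mass_off hP NA); case: eqP => // E.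
  rewrite /cond_mass asboolF ?mulr0 // => /chromatic_by_chromatic.
  by rewrite E.
have cA : chromatic_by (color_vector A) A by apply/chromatic_byP; case: NA.
have NE : cweight (color_vector A) = N by rewrite -csize_color_vector; case: NA.
rewrite NE eqxx; set m := color_vector A; rewrite -NE -/m.
rewrite /cond_mass asboolT // /W -/(binom m).
have b0 := lt0r_neq0 (binom_gt0 m); have m0 := lt0r_neq0 (monom_gt0 m).
suff E : P N A * monom p' m = monom p m * fine (mean_mass mu v A).
  by rewrite -[LHS](mulfK m0) NE E; field; rewrite b0 m0.
have [[k [mk pk]]|H] := pselect (exists k, (0 < m k)%N /\ p 0 k = 0).
  rewrite (monom_eq0 mk pk) mul0r; apply/eqP; rewrite mulf_eq0 (negbTE m0) orbF.
  have [a aA ak] : exists2 a, a \in A & (0 < a k)%N.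
    by apply: block_of_color; move: mk; rewrite /m ffunE.
  apply/eqP; apply: (mass_eq0 hP hmu); apply: filterS mass_p => x xp.
  have x0 i : nabla_seq x i 0 k = 0.
    by apply/eqP; rewrite eq_le nabla_ge0 andbT -pk -xp color_mass_ge.
  apply: (box_mass_eq0 _ _ aA ak).
  - by apply: extra_dust_ge0 => j; rewrite mxE.
  - exact: nabla_ge0.
  - by move=> i _; exact: monom_eq0 ak _.
  - by rewrite extra_dust0.
have vm k : (0 < m k)%N -> v 0 k = 0.
  by move=> mk; rewrite mxE; case: eqP => // pk; case: H; exists k.
have -> : monom p' m = monom p m.
  apply: eq_bigr => k _; have [mk|] := ltnP 0 (m k).
    by rewrite mxE vm // addr0.
  by rewrite leqn0 => /eqP ->; rewrite !expr0.
rewrite mulrC; congr (_ * _); apply: EFin_inj.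
rewrite (massE hmu NA) (fineK (E_fin cA)) /mean_mass; apply: eq_integral => x _.
rewrite /shifted_mass /box_mass; congr (_ * _)%E; apply: eq_placement_dust => k kA.
have dustE w : extra_dust w x 0 k = nabla_seq x 0%N 0 k + w 0 k by rewrite mxE.
rewrite !dustE vm; first by rewrite mxE.
rewrite /m ffunE.
by apply: leq_trans (ccount_ge k kA); rewrite cunit_diag.
Qed.

End Sufficiency.

Lemma partially_exchangeable_typeP : partially_exchangeable_type P <->
  exists2 p : 'rV[R]_q.+1, unit_simplex p &
    forall B : set (borel 'rV[R]_q.+1), measurable B ->
      pushforward mu (fun x => color_mass (nabla_seq x) : borel 'rV[R]_q.+1) B
        = dirac (p : borel 'rV[R]_q.+1) B.
Proof.
split=> [[p [Q [p1 [hQ _] PQ]]]|[p p1 /ae_pushforward mass_p]].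
  by exists p => //; apply/ae_pushforward; exact: (color_mass_ae hQ PQ).
exists p, (cond_mass p); split=> //.
  exact: cond_mass_exchangeable.
exact: mixture_cond_mass.
Qed.

End PartialExchangeability.

Theorem proposition3 (R : realType) (q : nat)
  (P : nat -> cpart q.+1 -> R)
  (mu : probability (borel (nabla_type R q)) R)
  (hP : partition_structure P)
  (hmu : forall (n : nat) (A : cpart q.+1), chromatic n A ->
     (P n A)%:E = (\int[mu]_x psi A (nabla_seq x))%E) :
  [/\ standard_structure P <->
        exists j : 'I_q.+1,
          {ae mu, forall x, forall i, prop_to_unit (nabla_seq x i) j},
      multipartition_structure P <->
        {ae mu, forall x, forall i, (1 <= i)%N ->
          exists j : 'I_q.+1, prop_to_unit (nabla_seq x i) j} &
      partially_exchangeable_type P <->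
        exists2 p : 'rV[R]_q.+1, unit_simplex p &
          forall B : set (borel 'rV[R]_q.+1), measurable B ->
            pushforward mu (fun x => color_mass (nabla_seq x) : borel 'rV[R]_q.+1) B
              = dirac (p : borel 'rV[R]_q.+1) B].
Proof.
have [P_prob _] := hP.
split; [exact: standard_structureP|exact: multipartition_structureP|].
exact: partially_exchangeable_typeP.
Qed.
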